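(* Let $p>1$, let $G=(V,E)$ be a connected finite graph, let $\lambda\in\mathbb{R}$ and $f:V\to\mathbb{R}$ satisfy $\lambda\int_V f\,d\mu<0$. Let $X=L^\infty(V)$ and define $F:X\to X$ by $$F(u)=-\Delta_p u+\lambda e^u(e^u-1)+f.$$ Then there exists $R_0>0$ such that for all $R\geqslant R_0$, $$\deg(F,B_R,0)=\operatorname{sgn}\lambda=\begin{cases}1,&\lambda>0,\\-1,&\lambda<0,\end{cases}$$ where $B_R=\{u\in X:\|u\|_{L^\infty(V)}<R\}$.
   Context: A finite graph $G=(V,E)$ has a finite vertex set $V$ and a set $E$ of undirected edges (with unit weights and unit vertex measure); $y\sim x$ means $xy\in E$. For $p>1$ and $u:V\to\mathbb{R}$, the $p$-Laplacian is $$\Delta_p u(x)=\sum_{y\sim x}|u(y)-u(x)|^{p-2}(u(y)-u(x)),$$ where, when $1<p<2$, terms with $u(y)=u(x)$ are taken to be $0$. For $g:V\to\mathbb{R}$, $\int_V g\,d\mu=\sum_{x\in V}g(x)$. $L^\infty(V)$ is the space of all functions $u:V\to\mathbb{R}$ with norm $\|u\|_{L^\infty(V)}=\sup_{x\in V}|u(x)|$, identified with the Euclidean space $\mathbb{R}^{|V|}$; $0\in X$ is the zero function. $\deg(F,B_R,0)$ is the topological (Brouwer) degree of $F$ in $B_R$ at $0$ (this includes the assertion that it is defined, i.e. $0\notin F(\partial B_R)$). *)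

(* Defs.v *)
From HB Require Import structures.
From mathcomp Require Import all_boot all_order all_algebra.
From mathcomp Require Import all_classical all_reals all_analysis.

Set Implicit Arguments.
Unset Strict Implicit.
Unset Printing Implicit Defensive.

Import Order.TTheory GRing.Theory Num.Theory.
Import numFieldNormedType.Exports.

Local Open Scope classical_set_scope.
Local Open Scope ring_scope.

Section BrouwerDegree.
Context {R : realType} {n : nat}.
Implicit Types (F G : 'rV[R]_n -> 'rV[R]_n) (A : set 'rV[R]_n) (y : 'rV[R]_n).

Definition frontier A : set 'rV[R]_n := closure A `\` interior A.

Definition degree_defined F A y : Prop :=
  [/\ open A, bounded_set A, {within closure A, continuous F} &
      forall x, frontier A x -> F x != y].

Definition C1_on G A : Prop :=
  forall x, A x -> differentiable G x /\ {for x, continuous (jacobian G)}.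

Definition regular_value G A y : Prop :=
  forall x, A x -> G x = y -> \det (jacobian G x) != 0.

(* The sum over the fibre of a regular value; a finitely supported sum, equal
   to 0 by convention if the fibre is infinite, which cannot happen for the
   maps G of [regular_approximation]. *)
Definition signed_count G A y : int :=
  \sum_(x \in [set x | A x /\ G x = y]) sgz (\det (jacobian G x)).

(* The last condition says max_(closure A) |G - F| < dist(y, F(frontier A)):
   both extrema are attained, closure A and frontier A being compact (the
   distance to the empty set is +oo). *)
Definition regular_approximation F A y G : Prop :=
  [/\ {within closure A, continuous G}, C1_on G A, regular_value G A y &
      forall x z, closure A x -> frontier A z -> `|G x - F x| < `|F z - y| ].

(* The analytic definition of the Brouwer degree: deg(F, A, y) is the sum of
   the signs of the Jacobian determinants over the fibre of y for a C^1
   regular approximation G of F; the sum is independent of G. The value is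
   meaningful only when [degree_defined F A y]. *)
Definition brouwer_degree F A y : int :=
  xget 0 [set d : int | exists2 G, regular_approximation F A y G &
                                   d = signed_count G A y].

End BrouwerDegree.

Section Graph.
Context {R : realType} {V : finType}.

Definition p_laplacian (p : R) (E : rel V) (u : V -> R) (x : V) : R :=
  \sum_(y | E x y) `|u y - u x| `^ (p - 2) * (u y - u x).

(* L^oo(V): a function on V is the row vector of its values along [enum V].
   The norm of 'rV is the maximum of the absolute values of the entries. *)
Definition fun_of (u : 'rV[R]_#|V|) : V -> R := fun x => u 0 (enum_rank x).

Definition of_fun (g : V -> R) : 'rV[R]_#|V| := \row_i g (enum_val i).

Definition chern_simons_map (p : R) (E : rel V) (lambda : R) (f : V -> R)
    (u : 'rV[R]_#|V|) : 'rV[R]_#|V| :=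
  let v := fun_of u in
  of_fun (fun x => - p_laplacian p E v x
                   + lambda * (expR (v x) * (expR (v x) - 1)) + f x).

End Graph.

Definition open_ball {R : realType} {n : nat} (r : R) : set 'rV[R]_n :=
  [set u | `|u| < r].

(* Main.v *)
(* The degree is computed combinatorially.  On a fine grid of the cube B_R, label
   each vertex by the signs of the coordinates of the map; the sum over the Kuhn
   simplices of the determinants of the labels is n! times the degree.  It depends
   only on the labels near the boundary (it vanishes on a closed torus), hence is
   invariant under homotopies without zeros on the boundary; it is n! sgn(det A)
   for a linear map A, by LU decomposition; and it localizes at the zeros, where a
   map with regular value 0 is homotopic to its linearization.  So every regular
   approximation has the same signed count.  Regular approximations exist by
   smoothing |t|^(p-2) t and subtracting a regular value, found by counting.

   Finally F is joined by a segment, without zeros on the boundary of B_R, to the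
   identity if lambda > 0, and to a linear map that reverses only the constants
   if lambda < 0.  Zeros on the boundary are excluded by the maximum principle, by
   the sum of the equation over V and, when the oscillation is large, by the
   p-Laplacian flux across a level set, which is too large to be balanced. *)

Require Import Defs.
From HB Require Import structures.
From mathcomp Require Import all_boot all_order all_algebra.
From mathcomp Require Import all_fingroup.
From mathcomp Require Import finmap.
From mathcomp Require Import all_classical all_reals all_analysis.
From mathcomp Require Import ring lra zify.

Set Implicit Arguments.
Unset Strict Implicit.
Unset Printing Implicit Defensive.

Import Order.TTheory GRing.Theory Num.Theory.
Import numFieldNormedType.Exports.

Local Open Scope classical_set_scope.
Local Open Scope ring_scope.

(** [brouwer_degree] picks by choice one of the possible signed counts, so such a count must be
    shown to exist and to be unique. This is done for maps that a segment without zeros on the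
    sphere joins to a linear isomorphism; no general degree theory is built. The difficulty in the
    estimates is that [e^u (e^u - 1)] is one-sided: it grows with [u] but stays bounded as [u] tends
    to minus infinity. Hence the maximum principle alone does not treat a point of height [-R], and
    the sign of the sum of [f] has to enter. The linear targets come from the constants. The sum of
    the equation over V, taken at a large positive constant, has the sign of [lambda]; at a very
    negative constant it has the sign of the sum of [f], which is opposite. So the constants are
    preserved or reversed in orientation according to the sign of [lambda], while minus the
    p-Laplacian is monotone and calls for a positive factor on the vectors of mean 0. Reversing the
    single line of constants gives a negative determinant in every dimension. *)

(** * A combinatorial degree on grids *)

(* n! times the signed volume of the image simplex [w 0, ..., w n]. *)
Definition simplex_det n (w : nat -> 'I_n -> int) : int :=
  \det (\matrix_(l < n, i < n) (w i.+1 l - w 0%N l)).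

(** Bordering the matrix of the vertices with a row of ones gives [M]. Subtracting its column 0 from
    the others, which is multiplication by [T], reduces [\det M] to the left side; expansion along
    the row of ones gives the right side. *)
Lemma simplex_det_facets n (w : nat -> 'I_n -> int) :
  simplex_det w =
  \sum_(i < n.+1) (-1) ^+ i * \det (\matrix_(l < n, r < n) w (bump i r) l).
Proof.
pose M : 'M[int]_(1 + n) :=
  \matrix_(l < n.+1, i < n.+1) oapp (w i) 1 (unlift ord0 l).
have defM : M = block_mx 1%:M (const_mx 1)
    (\col_l w 0%N l) (\matrix_(l < n, i < n) w i.+1 l).
  apply/matrixP => l i; rewrite [LHS]mxE.
  have l0 (k : 'I_1) : lshift n k = ord0 :> 'I_n.+1 by rewrite ord1; apply: val_inj.
  have lS (k : 'I_n) : rshift 1 k = lift ord0 k :> 'I_n.+1 by apply: val_inj.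
  case: (split_ordP l) => l' ->; case: (split_ordP i) => i' ->;
    rewrite ?(block_mxEul, block_mxEur, block_mxEdl, block_mxEdr);
    by rewrite ?mxE ?l0 ?lS ?unlift_none ?liftK ?ord1.
pose T : 'M[int]_(1 + n) := block_mx 1%:M (const_mx (-1)) 0 1%:M.
have detT : \det T = 1 by rewrite det_ublock !det1 mulr1.
have detM : \det M = simplex_det w.
  rewrite -[LHS]mulr1 -detT -det_mulmx defM mulmx_block !mulmx0 !mulmx1 !addr0.
  have -> : (1%:M : 'M[int]_1) *m (const_mx (-1) : 'rV[int]_n) + const_mx 1 = 0.
    by apply/matrixP => a b; rewrite mul1mx !mxE addNr.
  rewrite det_lblock det1 mul1r; congr (\det _).
  by apply/matrixP => l i; rewrite !mxE big_ord1 !mxE mulrN1 addrC.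
rewrite -detM (expand_det_row M ord0); apply: eq_bigr => i _.
rewrite mxE unlift_none /= mul1r /cofactor add0n; congr (_ * \det _).
by apply/matrixP => l r; rewrite !mxE liftK.
Qed.

Section Torus.
Variables (n m : nat).
Local Notation torus := {ffun 'I_n.+1 -> 'I_m.+1}.
Implicit Types (a : torus) (tau : 'S_n.+1).

(** Kuhn's triangulation with coordinates read modulo [m.+1]: the vertices of the simplex [tau] are
    reached from [a] by raising the coordinates one by one, in the order of their ranks [tau j]. *)
Definition torus_vertex a tau (i : nat) : torus :=
  [ffun j => a j + inZp (tau j < i)%N].

Definition facet_det (u : torus -> 'I_n.+1 -> int) (i : nat) a tau : int :=
  \det (\matrix_(l < n.+1, r < n.+1) u (torus_vertex a tau (bump i r)) l).

(** Exchanging the ranks [i.-1] and [i] moves only the [i]-th vertex: the result is the other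
    simplex of the cell with the same facet, and its sign is opposite. *)
Lemma facet_inner u i : (0 < i)%N -> (i < n.+1)%N ->
  \sum_(a : torus) \sum_(tau : 'S_n.+1) (-1) ^+ tau * facet_det u i a tau = 0.
Proof.
move=> i0 ilt; rewrite big1 // => a _.
have i1lt : (i.-1 < n.+1)%N by lia.
pose t : 'S_n.+1 := tperm (Ordinal i1lt) (Ordinal ilt).
set S := \sum_(tau : 'S_n.+1) _.
suff : S = - S by lia.
rewrite {1}/S (reindex_inj (mulIg t)) /= -sumrN; apply: eq_bigr => tau _.
have -> : (-1) ^+ (tau * t)%g = - (-1) ^+ tau :> int.
  rewrite odd_permM odd_tperm; case: eqP => [/(congr1 val)/=|_]; first by lia.
  by rewrite signr_addb mulrN1.
rewrite mulNr; congr (- (_ * _)); congr (\det _).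
apply/matrixP => l r; rewrite !mxE; congr (u _ _); apply/ffunP => j.
rewrite !ffunE permM; congr (_ + inZp _); congr nat_of_bool.
have ne_i : bump i r != i by rewrite eq_sym neq_bump.
rewrite /t; case: tpermP => [->|->|_ _] //=; move: ne_i; lia.
Qed.

(** The facet opposite to vertex 0 is shared with a simplex of the neighbouring cell [a + e], where
    it is opposite to the last vertex: the coordinate that was raised first is now raised last. The
    cycle [c] shifts the ranks accordingly and has sign [(-1) ^+ n]. *)
Lemma facet_outer u :
  \sum_(a : torus) \sum_(tau : 'S_n.+1) (-1) ^+ tau * facet_det u 0 a tau =
  (-1) ^+ n * \sum_(a : torus) \sum_(tau : 'S_n.+1)
    (-1) ^+ tau * facet_det u n.+1 a tau.
Proof.
pose c : 'S_n.+1 := lift_perm ord0 ord_max 1.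
have c0 : c ord0 = ord_max by rewrite lift_perm_id.
have cS (k : 'I_n) : c (lift ord0 k) = lift ord_max k.
  by rewrite lift_perm_lift perm1.
rewrite exchange_big [X in _ = _ * X]exchange_big /= mulr_sumr.
rewrite [RHS](reindex_inj (mulIg c)) /=; apply: eq_bigr => tau _.
pose e : torus := [ffun j => inZp (tau j == ord0)].
rewrite [in RHS](reindex_inj (addIr e)) mulr_sumr /=; apply: eq_bigr => a _.
have -> : (-1) ^+ (tau * c)%g = (-1) ^+ n * (-1) ^+ tau :> int.
  rewrite odd_permM odd_lift_perm odd_perm1 /= addbF signr_addb signr_odd.
  by rewrite mulrC.
rewrite !mulrA -expr2 sqrr_sign mul1r; congr (_ * _).
congr (\det _); apply/matrixP => l r; rewrite !mxE; congr (u _ _).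
apply/ffunP => j; rewrite !ffunE -addrA; congr (_ + _).
have -> : bump 0 r = r.+1 by [].
have -> : bump n.+1 r = r by rewrite /bump; case: ltnP (ltn_ord r) => //; lia.
have z0 : inZp false = 0 :> 'I_m.+1 by apply: val_inj; rewrite /= mod0n.
rewrite permM; case: (unliftP ord0 (tau j)) => [k|] ->.
  rewrite cS eq_sym (negbTE (neq_lift _ _)) z0 add0r; congr (inZp _).
  by rewrite /= /bump [(n <= k)%N]leqNgt (ltn_ord k).
rewrite c0 eqxx /= (_ : (n < r)%N = false) ?z0 ?addr0 //.
by have := ltn_ord r; lia.
Qed.

(* A map from a closed oriented manifold to Euclidean space has degree 0. *)
Lemma torus_simplex_det_sum (u : torus -> 'I_n.+1 -> int) :
  \sum_(a : torus) \sum_(tau : 'S_n.+1) (-1) ^+ tau *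
    simplex_det (fun i => u (torus_vertex a tau i)) = 0.
Proof.
have -> : \sum_(a : torus) \sum_(tau : 'S_n.+1) (-1) ^+ tau *
    simplex_det (fun i => u (torus_vertex a tau i)) =
  \sum_(i < n.+2) (-1) ^+ i * \sum_(a : torus) \sum_(tau : 'S_n.+1)
    (-1) ^+ tau * facet_det u i a tau.
  under [RHS]eq_bigr do rewrite mulr_sumr.
  rewrite [RHS]exchange_big; apply: eq_bigr => a _ /=.
  under [RHS]eq_bigr do rewrite mulr_sumr.
  rewrite [RHS]exchange_big; apply: eq_bigr => tau _ /=.
  rewrite simplex_det_facets mulr_sumr; apply: eq_bigr => i _.
  by rewrite mulrCA.
rewrite big_ord_recl big_ord_recr /= [X in _ + (X + _)]big1 => [|i _].
  rewrite expr0 mul1r facet_outer add0r -mulrDl (_ : bump 0 n = n.+1) //.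
  by rewrite exprS mulN1r addrN mul0r.
by rewrite facet_inner ?mulr0 //= /bump; have := ltn_ord i; lia.
Qed.

End Torus.

Section Box.
Variable n : nat.
Local Notation point := {ffun 'I_n.+1 -> nat}.
Implicit Types (u : point -> 'I_n.+1 -> int) (a b x y : point).

(* The i-th vertex of the simplex [tau] of Kuhn's triangulation of the cell at
   [a]; [tau j] is the rank at which the j-th coordinate is increased. *)
Definition cell_vertex a (tau : 'S_n.+1) (i : nat) : point :=
  [ffun j => (a j + (tau j < i))%N].

Definition cell_count u a : int := \sum_(tau : 'S_n.+1)
  (-1) ^+ tau * simplex_det (fun i => u (cell_vertex a tau i)).

Definition grid_point N (a : {ffun 'I_n.+1 -> 'I_N}) : point :=
  [ffun j => nat_of_ord (a j)].

Definition box_count N u : int :=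
  \sum_(a : {ffun 'I_n.+1 -> 'I_N}) cell_count u (grid_point a).

Lemma simplex_det_const (w : nat -> 'I_n.+1 -> int) l :
  (forall i, w i l = w 0%N l) -> simplex_det w = 0.
Proof.
move=> wl; rewrite /simplex_det (expand_det_row _ l) big1 // => i _.
by rewrite mxE wl subrr mul0r.
Qed.

(** Linearity in row [k], in the form that turns a difference of two counts into the count of one
    labelling. *)
Lemma simplex_detB (w w1 w2 : nat -> 'I_n.+1 -> int) k :
  (forall i, w i k = w1 i k - w2 i k) ->
  (forall i l, l != k -> w1 i l = w i l /\ w2 i l = w i l) ->
  simplex_det w = simplex_det w1 - simplex_det w2.
Proof.
move=> wk wl; rewrite /simplex_det.
rewrite (@determinant_multilinear _ _ _ (\matrix_(l, i) (w1 i.+1 l - w1 0%N l))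
  (\matrix_(l, i) (w2 i.+1 l - w2 0%N l)) k 1 (-1)) ?mul1r ?mulN1r //.
- by apply/matrixP => i j; rewrite !mxE !wk; ring.
- apply/matrixP => i j; rewrite !mxE.
  by rewrite !(wl _ (lift k i) _).1 // eq_sym neq_lift.
- apply/matrixP => i j; rewrite !mxE.
  by rewrite !(wl _ (lift k i) _).2 // eq_sym neq_lift.
Qed.

Lemma cell_count_const u a l c :
  (forall y, (forall j, a j <= y j <= (a j).+1)%N -> u y l = c) ->
  cell_count u a = 0.
Proof.
move=> ul; rewrite /cell_count big1 // => tau _.
rewrite (@simplex_det_const _ l) ?mulr0 // => i.
by rewrite !ul // => j; rewrite ffunE; case: (tau j < _)%N; lia.
Qed.

Lemma cell_count_shift u a b :
  cell_count (fun x => u [ffun j => (b j + x j)%N]) a =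
  cell_count u [ffun j => (b j + a j)%N].
Proof.
apply: eq_bigr => tau _; congr (_ * \det _); apply/matrixP => l i.
by rewrite !mxE; congr (u _ l - u _ l); apply/ffunP => j; rewrite !ffunE addnA.
Qed.

(** Serves twice: to place a box inside a larger torus, and to restrict a fine grid to the box
    around a zero. *)
Lemma box_count_sub u N M b : (forall j, b j + M <= N)%N ->
  box_count M (fun x => u [ffun j => (b j + x j)%N]) =
  \sum_(a : {ffun 'I_n.+1 -> 'I_N} | [forall j, (b j <= a j < b j + M)%N])
     cell_count u (grid_point a).
Proof.
move=> bN; have [M0|M0] := posnP M.
  subst M; rewrite /box_count !big1 // => [a /forallP/(_ ord0)|a _].
    by lia.
  by case: (a ord0).
case: M M0 bN => // M _ bN.
have N0 : (0 < N)%N by have := bN ord0; lia.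
case: N N0 bN => // N _ bN.
pose h (a : {ffun 'I_n.+1 -> 'I_M.+1}) : {ffun 'I_n.+1 -> 'I_N.+1} :=
  [ffun j => inord (b j + a j)].
pose h' (a : {ffun 'I_n.+1 -> 'I_N.+1}) : {ffun 'I_n.+1 -> 'I_M.+1} :=
  [ffun j => inord (a j - b j)].
have hE (a : {ffun 'I_n.+1 -> 'I_M.+1}) j : h a j = (b j + a j)%N :> nat.
  by rewrite ffunE inordK //; have := bN j; have := ltn_ord (a j); lia.
rewrite (reindex_onto h h') => [|a /forallP ab].
  rewrite (eq_bigl predT) => [|a].
    apply: eq_bigr => a _; rewrite cell_count_shift; congr cell_count.
    by apply/ffunP => j; rewrite ![grid_point _ _]ffunE hE [LHS]ffunE ffunE.
  apply/andP; split.
    by apply/forallP => j; rewrite hE leq_addr ltn_add2l ltn_ord.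
  by apply/eqP/ffunP => j; rewrite ffunE hE addKn inord_val.
apply/ffunP => j; apply: ord_inj; rewrite hE ffunE.
by case/andP: (ab j) => ? ?; rewrite inordK ?subnKC // ltn_subLR.
Qed.

End Box.

Section BoxInvariance.
Variables (n N : nat).
Local Notation point := {ffun 'I_n.+1 -> nat}.
Local Notation torus := {ffun 'I_n.+1 -> 'I_N.+3}.
Implicit Types (u : point -> 'I_n.+1 -> int) (a b x y : point).

Definition in_box x := forall j, (x j <= N)%N.
Definition grid_adjacent x y := forall j, (y j <= (x j).+1)%N /\ (x j <= (y j).+1)%N.

(* Near each boundary point of the box, [u] and [u'] are stuck at a common
   value of a common coordinate. *)
Definition boundary_compatible u u' := forall b, in_box b ->
  (exists j, b j = 0%N \/ b j = N) ->
  exists l c, forall y, in_box y -> grid_adjacent b y -> u y l = c /\ u' y l = c.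

(** Modulo [N.+3], the layer [N.+1] is next to the face [N] and the layer [N.+2] next to the face 0.
    The jump between the two faces takes place only in cells based at [N.+1], whose vertices all lie
    outside the box; hence two layers. *)
Let clamp (i : nat) : nat :=
  if (i <= N)%N then i else if i == N.+1 then N else 0%N.

Lemma torus_vertexE (a : torus) tau i j :
  torus_vertex a tau i j =
    (if a j + (tau j < i) == N.+3 then 0 else a j + (tau j < i))%N :> nat.
Proof.
rewrite ffunE /=; have := ltn_ord (a j).
rewrite [((_ < _)%N %% _)%N]modn_small; last by case: (tau j < i)%N.
case: eqP => [->|ne aj]; first by rewrite modnn.
by case: (tau j < i)%N ne => /= ?; rewrite modn_small //; lia.
Qed.

(* The box is embedded in a torus with two more layers in each direction; the
   functions are extended to them by clamping, and the difference of the
   [k]-th coordinates by 0, so that no cell outside the box contributes. *)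
Lemma box_count_eq_coord u u' k :
  (forall x l, l != k -> u x l = u' x l) -> boundary_compatible u u' ->
  box_count N u = box_count N u'.
Proof.
move=> eq_off compat; apply/eqP; rewrite -subr_eq0; apply/eqP.
pose inside (x : torus) := [forall j, (x j <= N)%N].
pose cl (x : torus) : point := [ffun j => clamp (x j)].
pose X (x : torus) (l : 'I_n.+1) : int :=
  if l == k then if inside x then u (cl x) k - u' (cl x) k else 0
  else u (cl x) l.
have := torus_simplex_det_sum X.
rewrite (bigID (fun a : torus => [forall j, (a j < N)%N])) /=.
rewrite [X in _ + X = _]big1 => [|a]; last first.
  rewrite negb_forall => /existsP[j0]; rewrite -leqNgt => aj0.
  rewrite big1 // => tau _.
  have [/existsP[j /eqP aj]|] := boolP [exists j, a j == N.+1 :> nat].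
    rewrite (@simplex_det_const _ _ k) ?mulr0 // => i; rewrite /X eqxx.
    have out i' : inside (torus_vertex a tau i') = false.
      apply/negP => /forallP/(_ j); rewrite torus_vertexE aj.
      by case: (tau j < _)%N => /=; case: eqP; lia.
    by rewrite !out.
  rewrite negb_exists => /forallP aN.
  (* Every other outer cell clamps to neighbours of one boundary point, where both labellings are
     stuck in a coordinate [l]. If [l] is [k], the label is 0 at all vertices of the cell, inside
     the box and outside. *)
  have [l [c lc]] : exists l c, forall i,
      u (cl (torus_vertex a tau i)) l = c /\ u' (cl (torus_vertex a tau i)) l = c.
    have [||l [c lc]] := compat (cl a).
    - by move=> j; rewrite ffunE /clamp; do 2?case: ifP; lia.
    - exists j0; rewrite ffunE /clamp; have := ltn_ord (a j0); have := aN j0.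
      by do 2?case: ifP; lia.
    exists l, c => i; apply: lc => j.
      by rewrite ffunE /clamp; do 2?case: ifP; lia.
    rewrite ![cl _ _]ffunE torus_vertexE; have := ltn_ord (a j); have := aN j.
    by rewrite /clamp; case: (tau j < _)%N => /=; do !case: ifP; lia.
  rewrite (@simplex_det_const _ _ l) ?mulr0 // => i; rewrite /X.
  case: (eqVneq l k) lc => [-> lc|_ lc]; last by rewrite !(lc _).1.
  by rewrite !(lc _).1 !(lc _).2 subrr !if_same.
rewrite addr0 => <-.
pose b0 : point := [ffun => 0%N].
have box_sum v : box_count N v =
    \sum_(a : torus | [forall j, (a j < N)%N]) cell_count v (grid_point a).
  have := @box_count_sub _ v N.+3 N b0 (fun=> _).
  under eq_bigl do under eq_forallb do rewrite ffunE /= add0n.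
  move=> <-; last by move=> j; rewrite ffunE; lia.
  congr box_count; apply/funext => x; congr v.
  by apply/ffunP => j; rewrite !ffunE.
rewrite !box_sum -sumrB; apply: eq_bigr => a /forallP aN.
rewrite -sumrB; apply: eq_bigr => tau _; rewrite -mulrBr; congr (_ * _).
apply/esym.
have clE i : cl (torus_vertex a tau i) = cell_vertex (grid_point a) tau i.
  apply/ffunP => j; rewrite [LHS]ffunE torus_vertexE !ffunE /clamp.
  by have := aN j; case: (tau j < _)%N => /=; do !case: ifP; lia.
apply: (@simplex_detB _ _ _ _ k) => [i|i l lk].
  rewrite /X eqxx clE; case: ifP => // /negP[]; apply/forallP => j.
  by rewrite torus_vertexE; have := aN j; case: (tau j < _)%N => /=; case: ifP; lia.
by rewrite /X (negbTE lk) clE eq_off.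
Qed.

(** Coordinates are exchanged one at a time. An intermediate labelling takes each coordinate from
    [u] or [u'], so a coordinate stuck at the same value for both is stuck for it too. *)
Lemma box_count_eq u u' : boundary_compatible u u' ->
  box_count N u = box_count N u'.
Proof.
move=> compat.
pose h t x (l : 'I_n.+1) := if (l < t)%N then u' x l else u x l.
have step (t : nat) : (t < n.+1)%N -> box_count N (h t) = box_count N (h t.+1).
  move=> tn; apply: (@box_count_eq_coord _ _ (Ordinal tn)) => [x l|b bN bb].
    by rewrite /h -val_eqE /= => lt; do 2?case: ifP => //; lia.
  have [l [c lc]] := compat b bN bb.
  by exists l, c => y yN ay; have [yu yu'] := lc y yN ay; rewrite /h; do 2!case: ifP.
have all_steps t : (t <= n.+1)%N -> box_count N (h 0%N) = box_count N (h t).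
  elim: t => // t IH tn; rewrite IH 1?ltnW //; exact: step.
have := all_steps n.+1 (leqnn _).
have -> : h 0%N = u by [].
have -> // : h n.+1 = u'.
by apply/funext => x; apply/funext => l; rewrite /h ltn_ord.
Qed.

End BoxInvariance.

(** * Homotopy invariance on the unit cube *)

Section RowVectors.
Variable R : realType.

Lemma rV_normE n (x : 'rV[R]_n) : `|x| = mx_norm x.
Proof. by []. Qed.

Lemma rV_coord_le n (x : 'rV[R]_n) j : `|x 0 j| <= `|x|.
Proof.
rewrite rV_normE mx_normrE.
exact: (le_bigmax _ (fun ij => `|x ij.1 ij.2|) (0, j)).
Qed.

Lemma rV_norm_le n (x : 'rV[R]_n) c :
  0 <= c -> (forall j, `|x 0 j| <= c) -> `|x| <= c.
Proof.
move=> c0 xc; rewrite rV_normE mx_normrE; apply: bigmax_le => // -[i j] _.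
by rewrite (ord1 i).
Qed.

Lemma rV_norm_lt n (x : 'rV[R]_n) c :
  0 < c -> (forall j, `|x 0 j| < c) -> `|x| < c.
Proof.
move=> c0 xc; rewrite rV_normE mx_normrE; apply: bigmax_lt => // -[i j] _.
by rewrite (ord1 i).
Qed.

Lemma rV_norm_coord n (x : 'rV[R]_n.+1) : exists j, `|x 0 j| = `|x|.
Proof.
have [x0|x0] := eqVneq (mx_norm x) 0.
  by exists ord0; rewrite (mx_norm_eq0 x0) mxE !normr0.
by have [[i j] /= xij] := mx_norm_neq0 x0; exists j; rewrite rV_normE xij ord1.
Qed.

End RowVectors.

Section Compactness.
Variable R : realType.

Lemma compact_lower_bound (T : topologicalType) (A : set T) (f : T -> R) :
  compact A -> continuous f -> (forall x, A x -> 0 < f x) ->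
  exists2 e, 0 < e & forall x, A x -> e <= f x.
Proof.
move=> cA cf fpos; have [->|/set0P A0] := eqVneq A set0; first by exists 1.
have [c cA' fc] := compact_EVT_min A0 cA (continuous_subspaceT cf).
by exists (f c) => [|x Ax]; [apply/fpos/set_mem|apply/fc/mem_set].
Qed.

Lemma compact_upper_bound (T : topologicalType) (A : set T) (f : T -> R) :
  compact A -> continuous f ->
  exists2 e, 0 < e & forall x, A x -> f x <= e.
Proof.
move=> cA cf; have [->|/set0P A0] := eqVneq A set0; first by exists 1.
have [c cA' fc] := compact_EVT_max A0 cA (continuous_subspaceT cf).
exists (`|f c| + 1) => [|x Ax]; first by rewrite ltr_wpDl.
by rewrite (le_trans (fc x (mem_set Ax))) // ler_wpDr // ler_norm.
Qed.

(** The point [y] is free to leave [A]; this is used below to move off the slice [e = 0] in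
    [smooth_power_uniform] and out of the ball in [mean_value_jacobian]. *)
Lemma compact_uniform (V W : normedModType R) (A : set V) (f : V -> W) (e : R) :
  compact A -> continuous f -> 0 < e ->
  exists2 d, 0 < d & forall x y, A x -> `|x - y| < d -> `|f x - f y| < e.
Proof.
move=> /compact_near_coveringP cA cf e0.
pose P (d : R) (x : V) := forall y, `|x - y| < d -> `|f x - f y| < e.
have := cA R (0 : R)^'+ P _ _; case.
  move=> x Ax.
  have e20 : 0 < e / 2 by rewrite divr_gt0.
  have /cvgrPdist_lt/(_ _ e20)/nbhs_ballP[d /= d0 fd] := cf x.
  exists (ball x (d / 2), [set t | 0 < t < d / 2]) => /=.
    split; first by apply: nbhsx_ballx; rewrite divr_gt0.
    near=> t; apply/andP; split => //; near: t; apply: nbhs_right_lt.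
    by rewrite divr_gt0.
  move=> [x' t] /= [+ /andP[t0 td]] y x'y; rewrite -ball_normE /= => xx'.
  have fx' : `|f x - f x'| < e / 2.
    by apply: fd; rewrite -ball_normE /=; lra.
  have fy : `|f x - f y| < e / 2.
    apply: fd; rewrite -ball_normE /=.
    by have := ler_distD x' x y; lra.
  by have := ler_distD (f x) (f x') (f y); rewrite [ `|f x' - f x|]distrC; lra.
move=> d /= d0 dP; exists (d / 2); first by rewrite divr_gt0.
move=> x y Ax; apply: (dP (d / 2)) => //=.
  by rewrite sub0r normrN gtr0_norm; lra.
by lra.
Unshelve. all: by end_near. Qed.

Lemma exists_inv_lt (e : R) : 0 < e ->
  exists N0 : nat, forall N : nat, (N0 <= N)%N -> (0 < N)%N /\ N%:R^-1 < e.
Proof.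
move=> e0; exists (Num.truncn e^-1).+1 => N leN.
have N0 : (0 < N)%N by exact: leq_trans leN.
have Ne : e^-1 < N%:R.
  have /andP[_ lt] := truncn_itv (ltW (eqbRL (invr_gt0 e) e0)).
  by apply: lt_le_trans lt _; rewrite ler_nat.
by split=> //; rewrite invf_plt ?posrE // ltr0n.
Qed.

End Compactness.

Section GridDegree.
Variables (R : realType) (n : nat).
Local Notation point := {ffun 'I_n.+1 -> nat}.
Local Notation vec := 'rV[R]_n.+1.
Implicit Types (g : vec -> vec) (N : nat).

Definition grid_real N (x : point) : vec := \row_j ((x j)%:R / N%:R).

Definition sign_label g N (x : point) (l : 'I_n.+1) : int :=
  (0 <= g (grid_real N x) 0 l)%R%:R.

(* n! times the degree of [g] on the unit cube when the mesh 1/N is fine enough: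
   the image simplices have vertices in {0,1}^n, and those with a constant
   coordinate are degenerate. *)
Definition grid_degree g N : int := box_count N (sign_label g N).

Definition unit_cube : set vec := [set x | forall j, 0 <= x 0 j <= 1].

Definition unit_boundary : set vec :=
  [set x | unit_cube x /\ exists j, x 0 j = 0 \/ x 0 j = 1].

Lemma unit_cube_compact : compact unit_cube.
Proof.
have := @rV_compact R n.+1 (fun=> `[0, 1]%classic) (fun=> @segment_compact R 0 1).
by congr compact; apply/seteqP; split => x /= xP j; have := xP j; rewrite in_itv.
Qed.

Lemma unit_boundary_compact : compact unit_boundary.
Proof.
have cl : closed [set x : vec | exists j, x 0 j = 0 \/ x 0 j = 1].
  have -> : [set x : vec | exists j, x 0 j = 0 \/ x 0 j = 1] =
      \bigcup_(j in setT) ([set x : vec | x 0 j = 0] `|` [set x | x 0 j = 1]).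
    apply/seteqP; split => x /=; first by case=> j xj; exists j.
    by case=> j _ xj; exists j.
  apply: closed_bigcup; first exact: finite_finset.
  move=> j _; apply: closedU.
    apply: (@preimage_closed _ _ (fun x : vec => x 0 j) [set 0]) => [?|].
      by move=> _; exact: coord_continuous.
    exact: closed_eq.
  apply: (@preimage_closed _ _ (fun x : vec => x 0 j) [set 1]) => [?|].
    by move=> _; exact: coord_continuous.
  exact: closed_eq.
have -> : unit_boundary =
    unit_cube `&` [set x : vec | exists j, x 0 j = 0 \/ x 0 j = 1] by [].
by apply: compact_closedI => //; exact: unit_cube_compact.
Qed.

Lemma grid_real_cube N x : (0 < N)%N -> in_box N x -> unit_cube (grid_real N x).
Proof.
move=> N0 xN j; rewrite mxE divr_ge0 //= ler_pdivrMr ?ltr0n // mul1r ler_nat.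
exact: xN.
Qed.

Lemma grid_real_boundary N x : (0 < N)%N -> in_box N x ->
  (exists j, x j = 0%N \/ x j = N) -> unit_boundary (grid_real N x).
Proof.
move=> N0 xN [j xj]; split; first exact: grid_real_cube.
exists j; rewrite mxE; case: xj => ->; first by left; rewrite mul0r.
by right; rewrite divff // pnatr_eq0 -lt0n.
Qed.

Lemma grid_real_adjacent N x y : (0 < N)%N -> grid_adjacent x y ->
  `|grid_real N x - grid_real N y| <= N%:R^-1.
Proof.
move=> N0 xy; apply: rV_norm_le => [|j]; first by rewrite invr_ge0.
rewrite !mxE -mulrBl normrM [ `|_^-1|]ger0_norm ?invr_ge0 //.
rewrite ler_piMl ?invr_ge0 // ler_norml; have [h1 h2] := xy j.
have : (y j)%:R <= (x j)%:R + 1 :> R by rewrite natr1 ler_nat.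
have : (x j)%:R <= (y j)%:R + 1 :> R by rewrite natr1 ler_nat.
by lra.
Qed.

Lemma same_sign (s t e : R) : e <= `|s| -> `|s - t| < e -> (0 <= t) = (0 <= s).
Proof.
case: (lerP 0 s) => s0; rewrite ?(ger0_norm s0) ?(ltr0_norm s0) ltr_norml.
  by move=> ? ?; apply/idP; lra.
by move=> ? ?; apply/negbTE; rewrite -ltNge; lra.
Qed.

Lemma convex_lt (s a b c : R) : 0 <= s -> s <= 1 -> b < c -> a < c ->
  (1 - s) * a + s * b < c.
Proof.
move=> s0 s1 bc ac; have : Num.max a b < c by rewrite gt_max ac.
have : a <= Num.max a b by rewrite le_max lexx.
have : b <= Num.max a b by rewrite le_max lexx orbT.
by move: (Num.max a b) => m; nra.
Qed.

(** At a boundary grid point some coordinate of [g] is at least [e] in absolute value. A step to a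
    neighbour and the passage to [g'] cost less than [e / 2] each, so together they cannot change
    its sign. *)
Lemma grid_degree_close g g' N (e : R) : (0 < N)%N -> 0 < e ->
  (forall x, unit_boundary x -> e <= `|g x|) ->
  (forall x y, unit_cube x -> unit_cube y -> `|x - y| <= N%:R^-1 ->
     `|g x - g y| < e / 2) ->
  (forall x, unit_cube x -> `|g x - g' x| < e / 2) ->
  grid_degree g N = grid_degree g' N.
Proof.
move=> N0 e0 ge gu gg'; apply: box_count_eq => b bN bb.
have := ge _ (grid_real_boundary N0 bN bb).
have [l <-] := rV_norm_coord (g (grid_real N b)) => el.
exists l, (0 <= g (grid_real N b) 0 l)%R%:R => y yN xy.
have gy := gu _ _ (grid_real_cube N0 bN) (grid_real_cube N0 yN)
  (grid_real_adjacent N0 xy).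
have g'y := gg' _ (grid_real_cube N0 yN).
have nle (x : vec) j : `|x 0 j| <= `|x| by exact: rV_coord_le.
have {}gy := le_lt_trans (nle _ l) gy; have {}g'y := le_lt_trans (nle _ l) g'y.
rewrite !mxE in gy g'y.
split; rewrite /sign_label (same_sign el) //; first by lra.
apply: le_lt_trans (ler_distD (g (grid_real N y) 0 l) _ _) _; lra.
Qed.

Definition segment_nonzero (A : set vec) g0 g1 := forall x (s : R), A x ->
  0 <= s <= 1 -> (1 - s) *: g0 x + s *: g1 x != 0.

(** The lower bound [e] on the boundary and the modulus of continuity are uniform in the parameter,
    so one mesh serves a whole chain of [m] small steps, with [m] chosen to make each step shorter
    than [e / 2]. *)
Lemma grid_degree_homotopy g0 g1 : continuous g0 -> continuous g1 ->
  segment_nonzero unit_boundary g0 g1 ->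
  exists N0, forall N, (N0 <= N)%N -> grid_degree g0 N = grid_degree g1 N.
Proof.
move=> c0 c1 ne0.
pose h (s : R) x := (1 - s) *: g0 x + s *: g1 x.
have [e e0 he] : exists2 e, 0 < e &
    forall s x, 0 <= s <= 1 -> unit_boundary x -> e <= `|h s x|.
  pose A := unit_boundary `*` (`[(0 : R), 1]%classic : set R).
  have cA : compact A.
    exact: compact_setX unit_boundary_compact (@segment_compact R 0 1).
  have ch : continuous (fun z : vec * R => `|h z.2 z.1|).
    move=> z; apply: (@continuous_comp _ _ _ (fun z => h z.2 z.1) Num.norm).
      apply: cvgD; apply: cvgZ.
      - by apply: cvgB; [exact: cvg_cst | exact: cvg_snd].
      - by apply: (cvg_comp _ _ (@cvg_fst _ _ _ _ _)); exact: c0.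
      - exact: cvg_snd.
      - by apply: (cvg_comp _ _ (@cvg_fst _ _ _ _ _)); exact: c1.
    exact: norm_continuous.
  have [|e e0 eA] := compact_lower_bound cA ch.
    by move=> [x s] /= [Ax]; rewrite /= in_itv /= normr_gt0 => /ne0; apply.
  exists e => // s x s01 bx; apply: (eA (x, s)); split => //=.
have e20 : 0 < e / 2 by rewrite divr_gt0.
have [d0 d00 u0] := compact_uniform unit_cube_compact c0 e20.
have [d1 d10 u1] := compact_uniform unit_cube_compact c1 e20.
have [K K0 gK] : exists2 K, 0 < K & forall x, unit_cube x -> `|g0 x - g1 x| <= K.
  apply: compact_upper_bound; first exact: unit_cube_compact.
  move=> x; apply: (@continuous_comp _ _ _ (fun x => g0 x - g1 x) Num.norm).
    by apply: continuousB; [exact: c0 | exact: c1].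
  exact: norm_continuous.
have [m /(_ m (leqnn m)) [m0 mK]] : exists m : nat, forall k : nat, (m <= k)%N ->
    (0 < k)%N /\ k%:R^-1 < e / 2 / K.
  by apply: exists_inv_lt; rewrite divr_gt0.
have [N0 N0d] : exists N0 : nat, forall N : nat, (N0 <= N)%N ->
    (0 < N)%N /\ N%:R^-1 < Num.min d0 d1.
  by apply: exists_inv_lt; rewrite lt_min d00.
exists N0 => N /N0d[Npos]; rewrite lt_min => /andP[Nd0 Nd1].
have mR : (0 : R) < m%:R by rewrite ltr0n.
have step (i : nat) : (i < m)%N ->
    grid_degree (h (i%:R / m%:R)) N = grid_degree (h (i.+1%:R / m%:R)) N.
  move=> im; have im' : i%:R / m%:R <= (1 : R).
    by rewrite ler_pdivrMr // mul1r ler_nat ltnW.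
  have i0 : (0 : R) <= i%:R / m%:R by rewrite divr_ge0.
  apply: (grid_degree_close Npos e0) => [x|x y Ax Ay xy|x Ax].
  - by apply: he; rewrite i0.
  - rewrite /h opprD addrACA -!scalerBr.
    apply: le_lt_trans (ler_normD _ _) _; rewrite normrZ [X in _ + X]normrZ.
    rewrite (ger0_norm i0) ger0_norm ?subr_ge0 //.
    have := u0 x y Ax (le_lt_trans xy Nd0); have := u1 x y Ax (le_lt_trans xy Nd1).
    exact: convex_lt.
  - have -> : h (i%:R / m%:R) x - h (i.+1%:R / m%:R) x = m%:R^-1 *: (g0 x - g1 x).
      apply/rowP => j; rewrite !mxE -natr1; field.
      by rewrite pnatr_eq0 -lt0n.
    rewrite normrZ gtr0_norm ?invr_gt0 //.
    apply: le_lt_trans (ler_wpM2l _ (gK x Ax)) _; first by rewrite invr_ge0 ltW.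
    by rewrite -ltr_pdivlMr.
have all_steps i : (i <= m)%N ->
    grid_degree (h 0) N = grid_degree (h (i%:R / m%:R)) N.
  elim: i => [|i IH] im; first by rewrite mul0r.
  by rewrite IH 1?ltnW // step.
have := all_steps m (leqnn m); rewrite divff ?gt_eqF //.
have -> : h 0 = g0 by apply/funext => x; rewrite /h subr0 scale1r scale0r addr0.
by have -> : h 1 = g1 by apply/funext => x; rewrite /h subrr scale1r scale0r add0r.
Qed.

End GridDegree.

(** * Degree of an affine isomorphism with its zero inside the cube *)

Section LinearMaps.
Variables (R : realType).

Lemma mulmx_norm_le m n (x : 'rV[R]_m) (A : 'M[R]_(m, n)) :
  `|x *m A| <= (m%:R * `|A|) * `|x|.
Proof.
apply: rV_norm_le => [|j]; first by rewrite !mulr_ge0.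
rewrite mxE; apply: le_trans (ler_norm_sum _ _ _) _.
have -> : m%:R * `|A| * `|x| = \sum_(i < m) `|A| * `|x|.
  by rewrite sumr_const card_ord -[RHS]mulr_natl mulrA.
apply: ler_sum => i _; rewrite normrM mulrC ler_pM ?rV_coord_le //.
rewrite [leRHS]mx_normrE.
exact: (le_bigmax _ (fun ij => `|A ij.1 ij.2|) (i, j)).
Qed.

Lemma lipschitz_continuous (V W : normedModType R) (f : V -> W) (K : R) :
  (forall x y, `|f x - f y| <= K * `|x - y|) -> continuous f.
Proof.
move=> fK x; apply/cvgrPdist_lt => e e0; pose K' := `|K| + 1.
have K'0 : 0 < K' by rewrite ltr_wpDl.
apply/nbhs_ballP; exists (e / K') => [|y]; first by rewrite /= divr_gt0.
rewrite -ball_normE /= ltr_pdivlMr // => lt_e.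
apply: le_lt_trans (fK _ _) _; apply: le_lt_trans lt_e.
by rewrite mulrC ler_wpM2l // (le_trans (ler_norm K)) // lerDl.
Qed.

Lemma mulmx_norm_ge n (A : 'M[R]_n) : A \in unitmx ->
  exists2 c, 0 < c & forall x : 'rV[R]_n, c * `|x| <= `|x *m A|.
Proof.
move=> uA; pose K := n%:R * `|invmx A| + 1.
have K0 : 0 < K by rewrite ltr_wpDl // mulr_ge0.
exists K^-1 => [|x]; first by rewrite invr_gt0.
rewrite ler_pdivrMl // -{1}(mulmxK uA x).
apply: le_trans (mulmx_norm_le _ _) _; rewrite ler_wpM2r //.
by rewrite lerDl.
Qed.

Variable n : nat.
Local Notation point := {ffun 'I_n.+1 -> nat}.
Local Notation vec := 'rV[R]_n.+1.
Implicit Types (A : 'M[R]_n.+1) (N : nat) (s : 'S_n.+1) (z : vec).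

Lemma det_unitriangular_le k :
  \det (\matrix_(i < k, j < k) ((i <= j)%N : int)%:~R) = 1 :> int.
Proof.
rewrite -det_tr det_trig; last first.
  by apply/is_trig_mxP => i j lt; rewrite !mxE leqNgt lt.
by rewrite big1 // => i _; rewrite !mxE leqnn.
Qed.

(** In each cell the matrix of a simplex is a diagonal matrix times a permutation matrix times the
    triangular matrix of ones. The sign of [tau] occurs twice and cancels, so all simplices
    contribute equally; the sum over the cells then factors into one telescoping sum per
    coordinate. *)
Lemma box_count_coords N (phi : 'I_n.+1 -> nat -> int) s :
  box_count N (fun x l => phi l (x (s l))) =
  (n.+1)`!%:R * ((-1) ^+ s * \prod_l (phi l N - phi l 0%N)).
Proof.
pose D l k := phi l k.+1 - phi l k.
transitivity (\sum_(a : {ffun 'I_n.+1 -> 'I_N})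
    (n.+1)`!%:R * ((-1) ^+ s * \prod_l D l (a (s l)))).
  apply: eq_bigr => a _; rewrite /cell_count.
  rewrite (eq_bigr (fun=> (-1) ^+ s * \prod_l D l (a (s l)))) => [|tau _].
    by rewrite sumr_const card_Sn mulr_natl.
  rewrite /simplex_det.
  set M := \matrix_(_, _) _.
  have -> : M = diag_mx (\row_l D l (a (s l))) *m
      row_perm (s * tau)%g (\matrix_(i, j) ((i <= j)%N : int)%:~R).
    apply/matrixP => l i; rewrite mul_diag_mx !mxE !ffunE permM ltnS addn0.
    by rewrite /D; case: leqP => _ /=; rewrite ?addn1 ?addn0 ?mulr1 ?mulr0 ?subrr.
  rewrite row_permE !det_mulmx det_diag det_perm det_unitriangular_le mulr1.
  rewrite odd_permM signr_addb; under eq_bigr do rewrite mxE.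
  have : (-1) ^+ tau * (-1) ^+ tau = 1 :> int by rewrite -expr2 sqrr_sign.
  move: (_ ^+ tau) (_ ^+ s) (\prod_(_ | _) _) => e f q ee.
  by transitivity (e * e * (f * q)); [ring|rewrite ee mul1r].
rewrite -!mulr_sumr; congr (_ * (_ * _)).
have prodE (a : {ffun 'I_n.+1 -> 'I_N}) :
    \prod_l D l (a (s l)) = \prod_j D ((s^-1)%g j) (a j).
  rewrite [RHS](reindex_inj (@perm_inj _ s)) /=.
  by apply: eq_bigr => l _; rewrite permK.
rewrite (eq_bigr _ (fun a _ => prodE a)).
rewrite -(bigA_distr_bigA (fun j (k : 'I_N) => D ((s^-1)%g j) k)).
rewrite [RHS](reindex_inj (@perm_inj _ s^-1%g)) /=; apply: eq_bigr => j _.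
by rewrite -(big_mkord xpredT (D _)) telescope_sumr.
Qed.

Definition interior_point z := forall j, 0 < z 0 j < 1.

(** Label [l] depends on a single coordinate of the grid point. As [z] is interior, it jumps by the
    sign of [d 0 l] between the two opposite faces, whatever the mesh. *)
Lemma grid_degree_perm_diag N s (d z : vec) : (0 < N)%N ->
  interior_point z -> (forall l, d 0 l != 0) ->
  grid_degree (fun x => (x - z) *m (perm_mx s *m diag_mx d)) N =
  (n.+1)`!%:R * sgz (\det (perm_mx s *m diag_mx d)).
Proof.
move=> N0 zP d0.
pose phi l k : int := (0 <= (k%:R / N%:R - z 0 ((s^-1)%g l)) * d 0 l)%R%:R.
have -> : grid_degree (fun x => (x - z) *m (perm_mx s *m diag_mx d)) N =
    box_count N (fun x l => phi l (x ((s^-1)%g l))).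
  congr box_count; apply/funext => x; apply/funext => l.
  rewrite /sign_label /phi mulmxA.
  have -> v : v *m perm_mx s = col_perm s^-1 v :> vec by rewrite col_permE invgK.
  by rewrite mul_mx_diag !mxE.
rewrite box_count_coords det_mulmx det_perm det_diag odd_permV; congr (_ * _).
rewrite sgzM; congr (_ * _); first by case: odd_perm; rewrite ?expr1 ?sgzN ?sgz1.
rewrite (big_morph _ (@sgzM _) (sgz1 _)); apply: eq_bigr => l _.
rewrite /phi divff ?pnatr_eq0 -?lt0n // mul0r sub0r.
have /andP[z0 z1] := zP ((s^-1)%g l).
move: (z 0 _) (d 0 l) (d0 l) z0 z1 => w c c0 w0 w1.
case: (ltrgt0P c) c0 => // c0 _.
  have -> : (0 <= (1 - w) * c) = true by rewrite mulr_ge0 ?subr_ge0 // ltW.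
  have -> : (0 <= - w * c) = false.
    by apply/negbTE; rewrite -ltNge mulNr oppr_lt0 mulr_gt0.
  by rewrite gtr0_sgz.
have -> : (0 <= - w * c) = true by rewrite mulNr oppr_ge0 mulr_ge0_le0 // ltW.
have -> : (0 <= (1 - w) * c) = false.
  by apply/negbTE; rewrite -ltNge nmulr_llt0 // subr_gt0.
by rewrite ltr0_sgz.
Qed.

Lemma grid_degree_affine_homotopy (A A' : 'M[R]_n.+1) z : interior_point z ->
  (forall t, \det ((1 - t) *: A + t *: A') != 0) ->
  exists N0, forall N, (N0 <= N)%N ->
    grid_degree (fun x => (x - z) *m A) N = grid_degree (fun x => (x - z) *m A') N.
Proof.
move=> zP dt.
have cont (B : 'M[R]_n.+1) : continuous (fun x : vec => (x - z) *m B).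
  apply: (@lipschitz_continuous _ _ _ (n.+1%:R * `|B|)) => x y.
  by rewrite -mulmxBl opprB addrA subrK; exact: mulmx_norm_le.
apply: grid_degree_homotopy => // x t [_ [j xj]] _.
rewrite !scalemxAr -mulmxDr; set B : 'M[R]_n.+1 := _ *: A + _; apply/eqP => xB.
have uB : B \in unitmx by rewrite unitmxE unitfE dt.
have := mulmxK uB (x - z); rewrite xB mul0mx => /rowP/(_ j)/eqP.
rewrite !mxE eq_sym.
by rewrite subr_eq0 => /eqP xz; have := zP j; case: xj => xj; lra.
Qed.

(** The factor [L] is moved linearly to the identity, then [U] to its diagonal. A triangular
    determinant sees only the diagonal, which stays fixed, so no singular matrix is met. *)
Lemma grid_degree_affine A z : interior_point z -> \det A != 0 ->
  exists N0, forall N, (N0 <= N)%N ->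
    grid_degree (fun x => (x - z) *m A) N = (n.+1)`!%:R * sgz (\det A).
Proof.
move=> zP dA.
have := cormen_lup_correct A; have := cormen_lup_perm A.
have := @cormen_lup_lower _ _ A; have := @cormen_lup_upper _ _ A.
have := cormen_lup_detL A.
case: (cormen_lup A) => [[P L] U] /= dL Uup Llow /is_perm_mxP[s ->] PA.
have defA : A = perm_mx s^-1 *m (L *m U).
  by rewrite -[L *m U]PA -[_ * A]/(_ *m A) mulmxA -perm_mxM mulVg perm_mx1 mul1mx.
pose D := diag_mx (\row_i U i i).
have dU : \det U != 0.
  by apply: contraNneq dA => dU; rewrite defA !det_mulmx dU !mulr0.
have ds (t : 'S_n.+1) : \det (perm_mx t : 'M[R]_n.+1) != 0.
  by rewrite det_perm signr_eq0.
have detU : \det U = \prod_i U i i.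
  rewrite -det_tr det_trig; first by apply: eq_bigr => i _; rewrite mxE.
  by apply/is_trig_mxP => i j lt; rewrite mxE Uup.
have detD : \det D = \det U.
  by rewrite det_diag detU; apply: eq_bigr => i _; rewrite mxE.
have [|N1 H1] := @grid_degree_affine_homotopy A (perm_mx s^-1 *m U) z zP.
  move=> t; have -> : (1 - t) *: A + t *: (perm_mx s^-1 *m U) =
      perm_mx s^-1 *m (((1 - t) *: L + t *: 1%:M) *m U).
    by rewrite defA mulmxDl mulmxDr -!scalemxAl -!scalemxAr mul1mx.
  rewrite !det_mulmx !mulf_neq0 // det_trig.
    by rewrite big1 ?oner_eq0 // => i _; rewrite !mxE Llow // eqxx !mulr1 subrK.
  apply/is_trig_mxP => i j lt; rewrite !mxE (Llow _ _ (ltnW lt)).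
  by rewrite -val_eqE /= (ltn_eqF lt) !mulr0 addr0.
have [|N2 H2] :=
    @grid_degree_affine_homotopy (perm_mx s^-1 *m U) (perm_mx s^-1 *m D) z zP.
  move=> t; rewrite !scalemxAr -mulmxDr det_mulmx mulf_neq0 //.
  rewrite -det_tr det_trig.
    have -> : \prod_i ((1 - t) *: U + t *: D)^T i i = \prod_i U i i.
      by apply: eq_bigr => i _; rewrite /D !mxE eqxx mulr1n; ring.
    by rewrite -detU.
  apply/is_trig_mxP => i j lt; rewrite /D !mxE (Uup _ _ lt).
  by rewrite -val_eqE /= (gtn_eqF lt) mulr0n !mulr0 addr0.
exists (maxn 1 (maxn N1 N2)) => N; rewrite !geq_max => /and3P[N0 NN1 NN2].
rewrite H1 // H2 // grid_degree_perm_diag //.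
  by rewrite defA !det_mulmx -/D detD dL mul1r.
move=> l; rewrite mxE; apply: contraNneq dU => Ull.
by rewrite detU (bigD1 l) //= Ull mul0r.
Qed.

End LinearMaps.

(** * Localization at regular zeros *)

Section UniformChoice.
Variables (R : realType) (T : eqType).

(** The property is asked for all small [d], so that finitely many bounds can be replaced by their
    minimum. *)
Lemma seq_uniform_real (s : seq T) (P : T -> R -> Prop) :
  (forall z, z \in s -> exists2 e, 0 < e & forall d, 0 < d -> d <= e -> P z d) ->
  exists2 e, 0 < e & forall z, z \in s -> forall d, 0 < d -> d <= e -> P z d.
Proof.
elim: s => [|a s IH] H; first by exists 1.
have [|e e0 He] := IH; first by move=> z zs; apply: H; rewrite inE zs orbT.
have [|d d0 Hd] := H a; first by rewrite inE eqxx.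
exists (Num.min d e) => [|z]; first by rewrite lt_min d0.
rewrite inE => /orP[/eqP->|zs] c c0; rewrite le_min => /andP[cd ce].
  exact: Hd.
exact: He.
Qed.

Lemma seq_uniform_nat (s : seq T) (P : T -> nat -> Prop) :
  (forall z, z \in s -> exists m, forall k, (m <= k)%N -> P z k) ->
  exists m, forall z, z \in s -> forall k, (m <= k)%N -> P z k.
Proof.
elim: s => [|a s IH] H; first by exists 0%N.
have [|e He] := IH; first by move=> z zs; apply: H; rewrite inE zs orbT.
have [|d Hd] := H a; first by rewrite inE eqxx.
exists (maxn d e) => z.
rewrite inE => /orP[/eqP->|zs] c; rewrite geq_max => /andP[cd ce].
  exact: Hd.
exact: He.
Qed.

End UniformChoice.

Section Excision.
Variables (R : realType) (n : nat).
Local Notation point := {ffun 'I_n.+1 -> nat}.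
Local Notation vec := 'rV[R]_n.+1.
Implicit Types (g : vec -> vec) (b : point).

(** The affine chart from the unit cube onto a box of three cells per side in the grid of mesh
    [1 / N1]. With three cells, a zero can be kept in the middle one, away from the faces. *)
Definition blowup b (N1 : nat) (x : vec) : vec :=
  \row_j (((b j)%:R + 3 * x 0 j) / N1%:R).

Definition open_box b (N1 : nat) : set vec :=
  [set x | forall j, (b j)%:R / N1%:R < x 0 j < (b j + 3)%:R / N1%:R].

Lemma open_box_compl_closed b N1 : closed (~` open_box b N1).
Proof.
have -> : ~` open_box b N1 = \bigcup_(j in setT)
    ([set x : vec | x 0 j <= (b j)%:R / N1%:R] `|`
     [set x | (b j + 3)%:R / N1%:R <= x 0 j]).
  apply/seteqP; split => x /=.
    move=> /existsNP[j /negP]; rewrite negb_and -!leNgt => /orP xj.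
    by exists j.
  move=> [j _ xj] /(_ j)/andP[x1 x2]; case: xj => /=; rewrite leNgt ?x1 //.
  by rewrite x2.
apply: closed_bigcup; first exact: finite_finset.
move=> j _; apply: closedU.
  apply: (@preimage_closed _ _ (fun x : vec => x 0 j)
    [set t | t <= (b j)%:R / N1%:R]) => [?|].
    by move=> _; exact: coord_continuous.
  exact: closed_le.
apply: (@preimage_closed _ _ (fun x : vec => x 0 j)
  [set t | (b j + 3)%:R / N1%:R <= t]) => [?|].
  by move=> _; exact: coord_continuous.
exact: closed_ge.
Qed.

Lemma sign_label_blowup g b N1 q (x : point) l : (0 < N1)%N -> (0 < q)%N ->
  sign_label (fun x => g (blowup b N1 x)) (3 * q) x l =
  sign_label g (N1 * q) [ffun j => (b j * q + x j)%N] l.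
Proof.
move=> N10 q0; rewrite /sign_label; congr (0 <= g _ 0 l)%R%:R.
apply/rowP => j; rewrite !mxE ffunE natrD !natrM; field.
by rewrite !pnatr_eq0 -!lt0n N10 q0.
Qed.

(* Cells that meet no box carry a coordinate of constant sign, and so do not
   contribute. *)
Lemma grid_degree_excision g (s : seq point) (N1 : nat) :
  continuous g -> (0 < N1)%N -> uniq s ->
  (forall b, b \in s -> forall j, b j + 3 <= N1)%N ->
  (forall b b', b \in s -> b' \in s -> b != b' ->
     exists j, b j + 3 <= b' j \/ b' j + 3 <= b j)%N ->
  (forall x, unit_cube x -> (forall b, b \in s -> ~ open_box b N1 x) ->
     g x != 0) ->
  exists q0, forall q, (q0 <= q)%N ->
    grid_degree g (N1 * q) =
    \sum_(b <- s) grid_degree (fun x => g (blowup b N1 x)) (3 * q).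
Proof.
move=> cg N10 us sN disj nz.
have [e e0 ge] : exists2 e, 0 < e & forall x, unit_cube x ->
    (forall b, b \in s -> ~ open_box b N1 x) -> e <= `|g x|.
  pose Z : set vec := @unit_cube R n `&` \bigcap_(b in [set` s]) ~` open_box b N1.
  have cZ : compact Z.
    apply: compact_closedI; first exact: unit_cube_compact.
    by apply: closed_bigI => b _; exact: open_box_compl_closed.
  have [||e e0 eZ] := @compact_lower_bound _ _ _ (fun x => `|g x|) cZ.
  - by move=> x; apply: (@continuous_comp _ _ _ g Num.norm);
      [exact: cg | exact: norm_continuous].
  - by move=> x [cx bx]; rewrite normr_gt0; apply: nz.
  by exists e => // x cx bx; apply: eZ; split.
have [d d0 ud] := compact_uniform (@unit_cube_compact R n) cg e0.
have [m mP] := exists_inv_lt d0.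
exists m.+1 => q mq; have q0 : (0 < q)%N by lia.
have [Nq0 Nd] : (0 < N1 * q)%N /\ (N1 * q)%:R^-1 < d.
  by apply: mP; rewrite (leq_trans (ltnW mq)) // leq_pmull.
pose P b (a : {ffun 'I_n.+1 -> 'I_(N1 * q)}) :=
  [forall j, (b j * q <= a j < b j * q + 3 * q)%N].
pose F := cell_count (sign_label g (N1 * q)).
have subE b : b \in s -> grid_degree (fun x => g (blowup b N1 x)) (3 * q) =
    \sum_(a | P b a) F (grid_point a).
  move=> bs; pose b' : point := [ffun j => (b j * q)%N].
  transitivity (box_count (3 * q)
      (fun x => sign_label g (N1 * q) [ffun j => (b' j + x j)%N])).
    congr box_count; apply/funext => x; apply/funext => l.
    rewrite sign_label_blowup //; congr sign_label.
    by apply/ffunP => j; rewrite !ffunE.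
  rewrite (box_count_sub _ (N := N1 * q)) => [|j].
    by apply: eq_bigl => a; apply: eq_forallb => j; rewrite ffunE.
  by rewrite ffunE -mulnDl leq_mul2r sN // orbT.
rewrite (eq_big_seq _ subE) (exchange_big_dep xpredT) //=.
apply: eq_bigr => a _; rewrite big_mkcond /=.
have [/hasP[b bs Pb]|/hasPn nP] := boolP (has (P^~ a) s).
  rewrite (bigD1_seq b) //= Pb big1_seq ?addr0 // => b' /andP[bb' b's].
  case: ifP => // Pb'; have [j] := disj _ _ b's bs bb'.
  have /andP[h1 h2] := forallP Pb j; have /andP[h3 h4] := forallP Pb' j.
  by case=> h; have := leq_mul h (leqnn q); rewrite mulnDl; lia.
rewrite big1_seq => [|b /= bs]; last by rewrite (negbTE (nP b bs)).
have aN : in_box (N1 * q) (grid_point a).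
  by move=> j; rewrite ffunE ltnW.
(* The cell is represented by its lower corner. A corner in none of the half-open index ranges lies
   in none of the open boxes. *)
have : e <= `|g (grid_real R (N1 * q) (grid_point a))|.
  apply: ge => [|b bs bo]; first exact: grid_real_cube.
  have /negP[] := nP b bs; apply/forallP => j.
  have := bo j; rewrite !mxE ffunE ltr_pdivlMr ?ltr0n // ltr_pdivrMr ?ltr0n //.
  rewrite natrM mulrA divfK ?pnatr_eq0 -?lt0n // mulrA divfK ?pnatr_eq0 -?lt0n //.
  by rewrite -!natrM !ltr_nat mulnDl; lia.
have [l <-] := rV_norm_coord (g (grid_real R (N1 * q) (grid_point a))) => el.
apply: (@cell_count_const _ _ _ l
  (0 <= g (grid_real R (N1 * q) (grid_point a)) 0 l)%R%:R) => y ya.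
have yN : in_box (N1 * q) y.
  by move=> j; have /andP[_] := ya j; rewrite ffunE => /leq_trans; apply.
rewrite /sign_label (same_sign el) //.
have adj : grid_adjacent (grid_point a) y.
  by move=> j; have := ya j; lia.
have := ud _ _ (grid_real_cube R Nq0 aN)
  (le_lt_trans (grid_real_adjacent R Nq0 adj) Nd).
apply: le_lt_trans.
have := rV_coord_le (g (grid_real R (N1 * q) (grid_point a)) -
  g (grid_real R (N1 * q) y)) l.
by rewrite !mxE.
Qed.

End Excision.

Section RegularZeros.
Variables (R : realType) (n : nat).
Local Notation point := {ffun 'I_n.+1 -> nat}.
Local Notation vec := 'rV[R]_n.+1.
Implicit Types (g : vec -> vec) (b : point) (z y : vec) (J : 'M[R]_n.+1).

Lemma segment_nonzero_close (a l : vec) (s : R) : `|a - l| < `|l| ->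
  0 <= s <= 1 -> (1 - s) *: a + s *: l != 0.
Proof.
move=> al /andP[s0 s1]; apply: contraTneq al => sum0.
have lE : l = - ((1 - s) *: (a - l)).
  apply/eqP; rewrite -subr_eq0 opprK; apply/eqP; rewrite -sum0.
  by apply/rowP => i; rewrite !mxE; ring.
rewrite -leNgt {1}lE normrN normrZ ger0_norm ?subr_ge0 //.
by rewrite ler_piMl // gerBl.
Qed.

(** Differentiability at [z] with Jacobian [J], together with [g z = 0], which is the case
    [y = z]. *)
Definition linearizes g z J := forall c : R, 0 < c ->
  exists2 rho, 0 < rho & forall y, `|y - z| <= rho ->
    `|g y - (y - z) *m J| <= c * `|y - z|.

(** One less than the integer part, so that [z] falls into the middle one of the three cells in
    every direction. *)
Definition box_base (N1 : nat) z : point :=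
  [ffun j => (Num.truncn (z 0 j * N1%:R)).-1].

Lemma box_baseP (N1 : nat) z (d : R) : (0 < N1)%N -> 4 <= d * N1%:R ->
  (forall j, d <= z 0 j <= 1 - d) ->
  forall j, (box_base N1 z j + 3 <= N1)%N /\
    (box_base N1 z j)%:R + 1 <= z 0 j * N1%:R < (box_base N1 z j)%:R + 2.
Proof.
move=> N10 dN zd j; have /andP[zd1 zd2] := zd j; rewrite ffunE.
have N1R : (0 : R) < N1%:R by rewrite ltr0n.
have z4 : 4 <= z 0 j * N1%:R by rewrite (le_trans dN) // ler_pM2r.
have zN : z 0 j * N1%:R <= N1%:R - 4.
  have : z 0 j * N1%:R <= (1 - d) * N1%:R by rewrite ler_pM2r.
  by rewrite mulrBl mul1r; lra.
have /truncn_itv/andP[k1 k2] : 0 <= z 0 j * N1%:R by lra.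
set k := Num.truncn _ in k1 k2 *.
have k0 : (0 < k)%N by rewrite -(@ltr_nat R); rewrite -natr1 in k2; lra.
have -> : (k.-1)%:R = k%:R - 1 :> R by rewrite -subn1 natrB.
have kN : (k + 4 <= N1)%N by rewrite -(ler_nat R) natrD; lra.
by split; [lia|rewrite -natr1 in k2; lra].
Qed.

(** In units of the mesh, a point lies between one and two above its corner. Points at least four
    apart in a coordinate therefore have corners at least three apart. *)
Lemma box_base_disjoint (N1 : nat) z z' (d : R) : (0 < N1)%N ->
  4 <= d * N1%:R -> (forall j, d <= z 0 j <= 1 - d) ->
  (forall j, d <= z' 0 j <= 1 - d) -> (exists j, d <= `|z 0 j - z' 0 j|) ->
  exists j, (box_base N1 z j + 3 <= box_base N1 z' j \/
             box_base N1 z' j + 3 <= box_base N1 z j)%N.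
Proof.
move=> N10 dN zd z'd [j zz']; exists j.
have N1R : (0 : R) < N1%:R by rewrite ltr0n.
have [_ /andP[a1 a2]] := box_baseP N10 dN zd j.
have [_ /andP[b1 b2]] := box_baseP N10 dN z'd j.
have : d * N1%:R <= `|z 0 j - z' 0 j| * N1%:R by rewrite ler_pM2r.
have [le|lt] := leP (z 0 j) (z' 0 j).
  rewrite ler0_norm ?subr_le0 // opprB mulrBl => h; left.
  by rewrite -ltnS -(ltr_nat R) -natr1 natrD; lra.
rewrite gtr0_norm ?subr_gt0 // mulrBl => h; right.
by rewrite -ltnS -(ltr_nat R) -natr1 natrD; lra.
Qed.

(** On the boundary of the box the linearization error is at most half of the lower bound for the
    linear part, so the segment between [g] and its linearization avoids 0. The blow-up only
    multiplies [J] by the positive factor [3 / N1]. *)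
Lemma grid_degree_linearized g z J b (N1 : nat) (rho c : R) :
  continuous g -> (0 < N1)%N -> \det J != 0 ->
  (forall j, (b j)%:R + 1 <= z 0 j * N1%:R < (b j)%:R + 2) ->
  0 < c -> (forall x : vec, c * `|x| <= `|x *m J|) -> 3 <= rho * N1%:R ->
  (forall y, `|y - z| <= rho -> `|g y - (y - z) *m J| <= c / 2 * `|y - z|) ->
  exists N0, forall N, (N0 <= N)%N ->
    grid_degree (fun x => g (blowup b N1 x)) N = (n.+1)`!%:R * sgz (\det J).
Proof.
move=> cg N10 dJ zb c0 cJ rN glin.
have N1R : (0 : R) < N1%:R by rewrite ltr0n.
have N1n0 : (N1%:R : R) != 0 by rewrite gt_eqF.
pose z' : vec := \row_j ((z 0 j * N1%:R - (b j)%:R) / 3).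
have z'P : interior_point z'.
  by move=> j; have := zb j; rewrite mxE ltr_pdivlMr // ltr_pdivrMr //; lra.
have dt : \det ((3 / N1%:R) *: J) = (3 / N1%:R) ^+ n.+1 * \det J.
  by rewrite detZ.
have t0 : 0 < 3 / N1%:R :> R by rewrite divr_gt0.
have [|N1' H1] := @grid_degree_affine _ n ((3 / N1%:R) *: J) z' z'P.
  by rewrite dt mulf_neq0 // expf_neq0 // gt_eqF.
have blowupE x : blowup b N1 x - z = (3 / N1%:R) *: (x - z').
  by apply/rowP => j; rewrite !mxE; field.
have [||| N2 H2] := @grid_degree_homotopy _ n (fun x => g (blowup b N1 x))
    (fun x => (x - z') *m ((3 / N1%:R) *: J)).
- move=> x; apply: (@continuous_comp _ _ _ (blowup b N1) g); last exact: cg.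
  apply: (@lipschitz_continuous _ _ _ _ (3 / N1%:R)) => {}x y.
  have -> : blowup b N1 x - blowup b N1 y = (3 / N1%:R) *: (x - y).
    by apply/rowP => j; rewrite !mxE; field.
  by rewrite normrZ gtr0_norm.
- apply: (@lipschitz_continuous _ _ _ _ (n.+1%:R * `|(3 / N1%:R) *: J|)) => x y.
  by rewrite -mulmxBl opprB addrA subrK; exact: mulmx_norm_le.
- move=> x s [xc [j xj]] s01.
  have -> : (x - z') *m ((3 / N1%:R) *: J) = (blowup b N1 x - z) *m J.
    by rewrite blowupE -scalemxAr scalemxAl.
  set y := blowup b N1 x.
  have yz : `|y - z| <= rho.
    rewrite blowupE normrZ gtr0_norm // mulrC.
    have : `|x - z'| <= 1.
      apply: rV_norm_le => // i; rewrite !mxE; have := zb i; have := xc i.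
      set w := _ / 3; have : w * 3 = z 0 i * N1%:R - (b i)%:R by rewrite divfK.
      by rewrite ler_norml; lra.
    rewrite -(ler_pM2r t0) mul1r => /le_trans; apply.
    by rewrite ler_pdivrMr.
  have yz0 : 0 < `|y - z|.
    rewrite normr_gt0 blowupE scaler_eq0 negb_or (gt_eqF t0) /=.
    apply/eqP => /rowP/(_ j)/eqP; rewrite !mxE subr_eq0 => /eqP xz.
    by have := z'P j; rewrite mxE -xz; case: xj => ->; lra.
  apply: segment_nonzero_close => //.
  apply: le_lt_trans (glin y yz) _; apply: lt_le_trans (cJ _).
  by rewrite ltr_pM2r // ltr_pdivrMr // ltr_pMr // ltr1n.
exists (maxn N1' N2) => N; rewrite geq_max => /andP[NN1 NN2].
rewrite H2 // H1 // dt sgzM (_ : sgz (_ ^+ _) = 1) ?mul1r //.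
by rewrite gtr0_sgz // exprn_gt0.
Qed.

(** One [d] serves all zeros: it bounds their distance to the faces and to each other, and gives a
    radius of good linearization. Only multiples of [N1] occur as grid sizes, because the boxes
    around the zeros must be unions of cells. *)
Lemma grid_degree_regular g (zs : seq vec) (J : vec -> 'M[R]_n.+1) :
  continuous g -> uniq zs ->
  (forall z, z \in zs ->
     [/\ interior_point z, \det (J z) != 0 & linearizes g z (J z)]) ->
  (forall x, unit_cube x -> g x = 0 -> x \in zs) ->
  exists2 N1, (0 < N1)%N & exists q0, forall q, (q0 <= q)%N ->
    grid_degree g (N1 * q) = (n.+1)`!%:R * \sum_(z <- zs) sgz (\det (J z)).
Proof.
move=> cg uzs zsP gzs.
have [d d0 dP] : exists2 d : R, 0 < d & forall z, z \in zs ->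
    forall d', 0 < d' -> d' <= d ->
    [/\ forall j, d' <= z 0 j <= 1 - d',
        forall z', z' \in zs -> z' != z -> exists j, d' <= `|z 0 j - z' 0 j|
      & exists2 c, 0 < c & (forall x : vec, c * `|x| <= `|x *m J z|) /\
          forall y, `|y - z| <= d' ->
            `|g y - (y - z) *m J z| <= c / 2 * `|y - z|].
  apply: seq_uniform_real => z zs_z; have [zi Jz lin] := zsP z zs_z.
  have [e1 e10 P1] : exists2 e, 0 < e & forall j, j \in enum 'I_n.+1 ->
      forall d', 0 < d' -> d' <= e -> d' <= z 0 j <= 1 - d'.
    apply: seq_uniform_real => j _; have /andP[z0 z1] := zi j.
    exists (Num.min (z 0 j) (1 - z 0 j)); first by rewrite lt_min z0 subr_gt0.
    by move=> d' d'0; rewrite le_min => /andP[? ?]; lra.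
  have [e2 e20 P2] : exists2 e, 0 < e & forall z', z' \in zs ->
      forall d', 0 < d' -> d' <= e ->
        z' != z -> exists j, d' <= `|z 0 j - z' 0 j|.
    apply: seq_uniform_real => z' _; have [->|ne] := eqVneq z' z.
      by exists 1.
    have [j zj] := rV_norm_coord (z - z').
    exists `|z - z'|; first by rewrite normr_gt0 subr_eq0 eq_sym.
    by move=> d' _ d'e _; exists j; rewrite -zj !mxE in d'e.
  have [|c c0 cJ] := @mulmx_norm_ge R _ (J z); first by rewrite unitmxE unitfE.
  have [|rho rho0 rP] := lin (c / 2); first by rewrite divr_gt0.
  exists (Num.min rho (Num.min e1 e2)); first by rewrite !lt_min rho0 e10.
  move=> d' d'0; rewrite !le_min => /and3P[d'r d'1 d'2]; split.
  - by move=> j; apply: P1 => //; rewrite mem_enum.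
  - by move=> z' z'zs; apply: P2.
  by exists c => //; split=> // y yz; apply: rP; exact: le_trans d'r.
have d4 : 0 < d / 4 by rewrite divr_gt0.
have [N1 /(_ N1 (leqnn _))[N10 N1d]] := exists_inv_lt d4.
have N1R : (0 : R) < N1%:R by rewrite ltr0n.
have dN : 4 <= d * N1%:R.
  rewrite -(ltr_pM2r N1R) mulVf ?gt_eqF // in N1d; lra.
have zd z : z \in zs -> forall j, d <= z 0 j <= 1 - d.
  by move=> /dP/(_ d d0 (lexx d))[].
have disj z z' : z \in zs -> z' \in zs -> z != z' ->
    exists j, (box_base N1 z j + 3 <= box_base N1 z' j \/
             box_base N1 z' j + 3 <= box_base N1 z j)%N.
  move=> zs_z zs_z' zz'; apply: (box_base_disjoint N10 dN); try exact: zd.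
  have [_ + _] := dP z zs_z d d0 (lexx d).
  by apply; rewrite // eq_sym.
exists N1 => //.
have [|b|b b'|x xc xb|q0 q0P] :=
    @grid_degree_excision _ _ g (map (box_base N1) zs) N1 cg N10.
- rewrite map_inj_in_uniq // => z z' zs_z zs_z' eq_b.
  apply/eqP; apply/negPn/negP => /(disj _ _ zs_z zs_z')[j].
  by rewrite eq_b; lia.
- by move=> /mapP[z zs_z ->] j; have [] := box_baseP N10 dN (zd z zs_z) j.
- move=> /mapP[z zs_z ->] /mapP[z' zs_z' ->] ne; apply: disj => //.
  by apply: contraNneq ne => ->.
- apply/eqP => gx0; have xzs := gzs x xc gx0.
  apply: (xb (box_base N1 x)); first exact: map_f.
  move=> j; have [_] := box_baseP N10 dN (zd x xzs) j.
  by rewrite ltr_pdivrMr // ltr_pdivlMr // natrD; lra.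
have [m mP] : exists m, forall z, z \in zs -> forall k, (m <= k)%N ->
    grid_degree (fun x => g (blowup (box_base N1 z) N1 x)) k =
    (n.+1)`!%:R * sgz (\det (J z)).
  apply: seq_uniform_nat => z zs_z; have [zi Jz _] := zsP z zs_z.
  have [_ _ [c c0 [cJ lin]]] := dP z zs_z d d0 (lexx d).
  apply: (@grid_degree_linearized g z (J z) _ N1 d c) => // [j|].
    by have [] := box_baseP N10 dN (zd z zs_z) j.
  by apply: le_trans dN; rewrite ler_nat.
exists (maxn q0 m) => q; rewrite geq_max => /andP[q0q mq].
rewrite q0P // big_map mulr_sumr; apply: eq_big_seq => z zs_z.
by rewrite mP // (leq_trans mq) // leq_pmull.
Qed.

End RegularZeros.

(** * Regular approximations have the same signed count *)

Section OpenBall.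
Variables (R : realType) (n : nat).
Local Notation vec := 'rV[R]_n.
Implicit Types (r : R).

Lemma open_ballE r : open_ball r = ball (0 : vec) r.
Proof. by apply/seteqP; split=> x; rewrite -ball_normE /= sub0r normrN. Qed.

Lemma closure_open_ball r : 0 < r ->
  closure (open_ball r : set vec) = [set x | `|x| <= r].
Proof.
move=> r0; rewrite open_ballE -[closure _]/(closed_ball _ _) closed_ballE //.
by apply/seteqP; split=> x; rewrite /closed_ball_ /= sub0r normrN.
Qed.

Lemma open_open_ball r : open (open_ball r : set vec).
Proof. by rewrite open_ballE; exact: ball_open. Qed.

Lemma frontier_open_ball r : 0 < r ->
  frontier (open_ball r : set vec) = [set x | `|x| = r].
Proof.
move=> r0; rewrite /frontier closure_open_ball //.
rewrite (_ : (open_ball r)^° = open_ball r); last first.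
  apply/seteqP; split; first exact: interior_subset.
  by have := @open_open_ball r; rewrite openE.
apply/seteqP; split=> x; rewrite /open_ball /=.
  by move=> [xr /negP]; rewrite -leNgt => ?; apply/eqP; rewrite eq_le xr.
by move=> ->; rewrite lexx ltxx.
Qed.

Lemma closed_ball_compact r : compact [set x : vec | `|x| <= r].
Proof.
apply: bounded_closed_compact.
  by exists r; split=> [|M rM x /= xr]; [exact: num_real|rewrite (le_trans xr) ?ltW].
apply: (@preimage_closed _ _ (fun x : vec => `|x|) [set t | t <= r]) => [? _|].
  exact: norm_continuous.
exact: closed_le.
Qed.

End OpenBall.

Section SignedCount.
Variables (R : realType) (n : nat).
Local Notation vec := 'rV[R]_n.+1.
Implicit Types (F G : vec -> vec) (A : 'M[R]_n.+1) (r : R).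

Lemma differentiable_linearizes G z (c : R) : differentiable G z -> 0 < c ->
  exists2 rho, 0 < rho & forall y, `|y - z| <= rho ->
    `|G y - G z - (y - z) *m jacobian G z| <= c * `|y - z|.
Proof.
move=> /diff_locallyP[_ /eqaddoP/(_ c)] + c0 => /(_ c0).
move=> /nbhs_ballP[d /= d0 dP]; exists (d / 2); first by rewrite divr_gt0.
move=> y yz; have := dP (y - z); rewrite -ball_normE /= sub0r normrN.
rewrite /jacobian mul_rV_lin1 !fctE /= subrK opprD addrA; apply.
by apply: le_lt_trans yz _; lra.
Qed.

(** The closed ball of the maximum norm is a cube, and clamping each coordinate retracts the space
    onto it. It extends maps that are continuous only on the closed ball to globally continuous
    ones, as the grid degree requires. *)
Definition retract r (x : vec) : vec := \row_j Num.max (- r) (Num.min r (x 0 j)).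

Lemma retract_norm_le r x : 0 <= r -> `|retract r x| <= r.
Proof.
move=> r0; apply: rV_norm_le => // j; rewrite mxE ler_norml.
by rewrite le_max lexx /= ge_max ge_min lexx andbT (le_trans _ r0) ?oppr_le0.
Qed.

Lemma retract_id r x : `|x| <= r -> retract r x = x.
Proof.
move=> xr; apply/rowP => j; rewrite mxE.
have := le_trans (rV_coord_le x j) xr; rewrite ler_norml => /andP[x1 x2].
by rewrite min_r // max_r.
Qed.

Lemma max_lipschitz (c s t : R) : `|Num.max c s - Num.max c t| <= `|s - t|.
Proof.
wlog st : s t / s <= t.
  by move=> wl; have [/wl //|/ltW/wl] := leP s t; rewrite distrC [leRHS]distrC.
have sm : s <= Num.max c s by rewrite le_max lexx orbT.
have cm : c <= Num.max c s by rewrite le_max lexx.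
have mm : Num.max c s <= Num.max c t.
  by rewrite ge_max !le_max lexx st orbT.
have mt : Num.max c t <= Num.max c s + (t - s) by rewrite ge_max; lra.
by rewrite distrC [leRHS]distrC !ger0_norm ?subr_ge0 //; lra.
Qed.

Lemma min_lipschitz (c s t : R) : `|Num.min c s - Num.min c t| <= `|s - t|.
Proof.
have := max_lipschitz (- c) (- s) (- t).
by rewrite -!oppr_min -!opprD !normrN.
Qed.

Lemma retract_continuous r : continuous (retract r).
Proof.
apply: (@lipschitz_continuous _ _ _ _ 1) => x y; rewrite mul1r.
apply: rV_norm_le => // j; apply: le_trans (rV_coord_le (x - y) j).
rewrite !mxE; move: (x 0 j) (y 0 j) => a b.
exact: le_trans (max_lipschitz _ _ _) (min_lipschitz _ _ _).
Qed.

Lemma continuous_comp_retract F r : 0 <= r ->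
  {within [set x | `|x| <= r], continuous F} -> continuous (F \o retract r).
Proof.
move=> r0 /subspace_continuousP cF x U /= FU.
have nU : nbhs (retract r x) [set y | `|y| <= r -> U (F y)].
  exact: cF (retract r x) (retract_norm_le x r0) U FU.
have := @retract_continuous r x _ nU; rewrite !nbhs_simpl /=.
by apply: filterS => y /(_ (retract_norm_le y r0)).
Qed.

Definition chart r (x : vec) : vec := \row_j (r * (2 * x 0 j - 1)).
Definition chart_inv r (x : vec) : vec := \row_j ((x 0 j / r + 1) / 2).

Lemma chartK r : 0 < r -> cancel (chart r) (chart_inv r).
Proof. by move=> r0 x; apply/rowP => j; rewrite !mxE; field; rewrite gt_eqF. Qed.

Lemma chart_invK r : 0 < r -> cancel (chart_inv r) (chart r).
Proof. by move=> r0 x; apply/rowP => j; rewrite !mxE; field; rewrite gt_eqF. Qed.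

Lemma chartB r x y : chart r x - chart r y = (2 * r) *: (x - y).
Proof. by apply/rowP => j; rewrite !mxE; ring. Qed.

Lemma chart_norm_le r x : 0 < r -> unit_cube x -> `|chart r x| <= r.
Proof.
move=> r0 xc; apply: rV_norm_le => [|j]; first exact: ltW.
rewrite mxE normrM gtr0_norm // ler_piMr ?(ltW r0) // ler_norml.
by have := xc j; lra.
Qed.

Lemma chart_boundary r x : 0 < r -> unit_boundary x -> `|chart r x| = r.
Proof.
move=> r0 [xc [j xj]]; apply/eqP; rewrite eq_le chart_norm_le //=.
apply: le_trans (rV_coord_le _ j); rewrite mxE normrM gtr0_norm //.
by case: xj => ->; rewrite ler_peMr ?(ltW r0) // ler_normr; lra.
Qed.

Lemma chart_inv_interior r x : 0 < r -> `|x| < r -> interior_point (chart_inv r x).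
Proof.
move=> r0 xr j; rewrite mxE.
have := le_lt_trans (rV_coord_le x j) xr; rewrite ltr_norml => /andP[x1 x2].
have : -1 < x 0 j / r < 1.
  by rewrite ltr_pdivlMr // ltr_pdivrMr // mulN1r mul1r x1.
by lra.
Qed.

Lemma chart_continuous r : continuous (chart r).
Proof.
apply: (@lipschitz_continuous _ _ _ _ `|2 * r|) => x y.
by rewrite chartB normrZ.
Qed.

(** Each point of the closed ball has a neighbourhood containing no zero other than itself: by
    continuity where [G] is nonzero, by the invertible derivative at a zero. Compactness concludes,
    so [signed_count] is a true sum and not the default 0. *)
Lemma regular_fibre_finite G r : 0 < r ->
  {within [set x | `|x| <= r], continuous G} ->
  (forall x, `|x| = r -> G x != 0) ->
  (forall x, `|x| < r -> G x = 0 ->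
     differentiable G x /\ \det (jacobian G x) != 0) ->
  finite_set [set x | `|x| < r /\ G x = 0].
Proof.
move=> r0 cG nb reg.
have isolated x : exists rho, 0 < rho /\
    (`|x| <= r -> forall y, `|y - x| < rho -> `|y| <= r -> G y = 0 -> y = x).
  have [xr|] := leP `|x| r; last by exists 1; split.
  have [Gx|Gx] := eqVneq (G x) 0.
    have xr' : `|x| < r.
      by rewrite lt_neqAle xr andbT; apply/eqP => /nb; rewrite Gx eqxx.
    have [dG dJ] := reg x xr' Gx.
    have [|c c0 cJ] := @mulmx_norm_ge R _ (jacobian G x).
      by rewrite unitmxE unitfE.
    have [|rho rho0 rP] := differentiable_linearizes (c := c / 2) dG.
      by rewrite divr_gt0.
    exists rho; split=> // _ y /ltW/rP + _ Gy; rewrite Gy Gx subrr sub0r normrN.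
    move=> /(le_trans (cJ _)) h; apply/eqP; rewrite -subr_eq0 -normr_le0.
    by move: h; move: (`|y - x|) => t; nra.
  have /subspace_continuousP/(_ x xr) := cG.
  have G0 : 0 < `|G x| by rewrite normr_gt0.
  move=> /cvgrPdist_lt/(_ _ G0)/nbhs_ballP[d /= d0 dP].
  exists d; split=> // _ y yx yr Gy.
  have : `|G x - G y| < `|G x|.
    by apply: dP => //; rewrite -ball_normE /= distrC.
  by rewrite Gy subr0 ltxx.
have [rho rhoP] := choice isolated.
have := @closed_ball_compact R n.+1 r; rewrite compact_cover.
move=> /(_ _ [set x | `|x| <= r] (fun x => ball x (rho x))).
case=> [x _|x /= xr|D Dr Dcov]; first exact: ball_open.
  by exists x => //; apply: ballxx; case: (rhoP x).
apply: (sub_finite_set _ (finite_fset D)) => x [/ltW xr Gx].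
have [y /= yD] := Dcov x xr; rewrite -ball_normE /= distrC => xy.
have yr : `|y| <= r by have := Dr y yD; rewrite inE.
by rewrite (_ : x = y) //; apply: (rhoP y).2.
Qed.

(** On the sphere [G] is closer to [F] than [F] is to 0, so [G] is homotopic to [F], and [F] to the
    linear map. The grid degree counts the zeros of [G] at one end and gives the sign of [\det A] at
    the other; the common factorial cancels. *)
Lemma signed_count_linear_homotopic F G A r : 0 < r ->
  {within closure (open_ball r : set vec), continuous F} ->
  regular_approximation F (open_ball r) 0 G -> \det A != 0 ->
  (forall z s, `|z| = r -> 0 <= s <= 1 -> (1 - s) *: F z + s *: (z *m A) != 0) ->
  signed_count G (open_ball r) 0 = sgz (\det A).
Proof.
move=> r0; rewrite closure_open_ball // => cF.
case; rewrite closure_open_ball // frontier_open_ball //= => cG C1G regG GF dA hom.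
have r2 : 0 < 2 * r by rewrite mulr_gt0.
have nb x : `|x| = r -> G x != 0.
  move=> xr; have := GF x x _ xr; rewrite xr subr0 => /(_ (lexx _)).
  by apply: contraTneq => ->; rewrite sub0r normrN ltxx.
have fin : finite_set [set x | open_ball r x /\ G x = 0].
  apply: (regular_fibre_finite r0 cG nb) => x xr Gx; split; last exact: regG.
  by have [] := C1G x xr.
rewrite /signed_count fsbig_finite //=.
set zs : seq vec := enum_fset _.
have zsP x : (x \in zs) = (`|x| < r) && (G x == 0).
  have -> : (x \in zs) = (x \in fset_set [set x | open_ball r x /\ G x = 0]) by [].
  by rewrite in_fset_set //; apply/idP/andP => [/set_mem[? ->]|[? /eqP ?]] //;
    exact/mem_set.
pose g := (G \o retract r) \o chart r.
pose f := (F \o retract r) \o chart r.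
have cg : continuous g.
  move=> x; apply: continuous_comp; first exact: chart_continuous.
  by apply: continuous_comp_retract => //; exact: ltW.
have cf : continuous f.
  move=> x; apply: continuous_comp; first exact: chart_continuous.
  by apply: continuous_comp_retract => //; exact: ltW.
have cube_r x : unit_cube x -> retract r (chart r x) = chart r x.
  by move=> xc; rewrite retract_id ?chart_norm_le.
pose J x := (2 * r) *: jacobian G (chart r x).
have [|z|x xc|N1 N10 [q0 q0P]] :=
    @grid_degree_regular R n g (map (chart_inv r) zs) J cg.
- by rewrite map_inj_uniq ?fset_uniq //; exact: can_inj (chart_invK r0).
- move=> /mapP[x]; rewrite zsP => /andP[xr /eqP Gx] ->; split.
  + exact: chart_inv_interior.
  + rewrite /J chart_invK // detZ mulf_neq0 ?expf_neq0 ?(gt_eqF r2) //; exact: regG.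
  move=> c c0; have [dG _] := C1G x xr.
  have [|rho rho0 rP] := differentiable_linearizes (c := c / (2 * r)) dG.
    by rewrite divr_gt0.
  (* The bound [r - |x|] keeps [chart r y] in the closed ball, where [retract] is the identity;
     [2 * r] is the scale of the chart. *)
  exists (Num.min rho (r - `|x|) / (2 * r)).
    by rewrite divr_gt0 // lt_min rho0 subr_gt0.
  move=> y; rewrite ler_pdivlMr // le_min => /andP[yrho yr].
  have yE : chart r y - x = (2 * r) *: (y - chart_inv r x).
    by rewrite -chartB chart_invK.
  have ynorm : `|chart r y - x| = `|y - chart_inv r x| * (2 * r).
    by rewrite yE normrZ gtr0_norm // mulrC.
  have := rP (chart r y); rewrite ynorm => /(_ yrho); rewrite Gx subr0.
  rewrite /g /= retract_id; last first.
    have := ler_normD x (chart r y - x); rewrite addrC subrK ynorm; lra.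
  rewrite /J chart_invK // yE -scalemxAl -scalemxAr => /le_trans; apply.
  by rewrite mulrA mulrAC divfK ?(gt_eqF r2).
- rewrite /g /= cube_r // => Gx; apply/mapP; exists (chart r x); last by rewrite chartK.
  have := chart_norm_le r0 xc; rewrite zsP Gx eqxx andbT le_eqVlt => /orP[/eqP|//].
  by move=> /nb; rewrite Gx eqxx.
pose k (x : vec) := (x - chart_inv r 0) *m ((2 * r) *: A).
have kE x : k x = chart r x *m A.
  by rewrite /k -scalemxAr scalemxAl -chartB chart_invK // subr0.
have ck : continuous k.
  apply: (@lipschitz_continuous _ _ _ _ (n.+1%:R * `|(2 * r) *: A|)) => x y.
  by rewrite -mulmxBl opprB addrA subrK; exact: mulmx_norm_le.
have [|m1 m1P] := @grid_degree_homotopy R n g f cg cf.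
  move=> x s xb s01; apply: segment_nonzero_close => //.
  have xr := chart_boundary r0 xb; rewrite /g /f /= !retract_id ?xr //.
  by have := GF (chart r x) (chart r x); rewrite xr subr0; apply.
have [|m2 m2P] := @grid_degree_homotopy R n f k cf ck.
  move=> x s xb s01; rewrite kE /f /=.
  have xr := chart_boundary r0 xb; rewrite !retract_id ?xr //; exact: hom.
have [||m3 m3P] := @grid_degree_affine R n ((2 * r) *: A) (chart_inv r 0).
- by apply: chart_inv_interior; rewrite ?normr0.
- by rewrite detZ mulf_neq0 ?expf_neq0 ?(gt_eqF r2).
(* The grid size [N1 * q] is admissible in all four results at once. *)
pose q := maxn q0 (maxn m1 (maxn m2 m3)).
have qN : (q <= N1 * q)%N by rewrite leq_pmull.
have fact0 : (n.+1)`!%:R != 0 :> int by rewrite pnatr_eq0 -lt0n fact_gt0.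
have sg c x : 0 < c -> sgz (\det (c *: x : 'M[R]_n.+1)) = sgz (\det x).
  by move=> c0; rewrite detZ sgzM gtr0_sgz ?mul1r // exprn_gt0.
apply: (mulfI fact0); rewrite -(sg (2 * r)) // -/k -(m3P (N1 * q)%N).
  rewrite -[grid_degree _ _]/(grid_degree k _) -m2P -?m1P; last 2 first.
  - by rewrite (leq_trans _ qN) // /q; lia.
  - by rewrite (leq_trans _ qN) // /q; lia.
  rewrite q0P; last by rewrite /q; lia.
  congr (_ * _); rewrite big_map; apply: eq_bigr => x _.
  by rewrite /J chart_invK // sg.
by rewrite (leq_trans _ qN) // /q; lia.
Qed.

End SignedCount.

(** * Existence of regular values *)

Section MeanValue.
Variables (R : realType) (n : nat).
Local Notation vec := 'rV[R]_n.+1.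
Implicit Types (H : vec -> vec) (x y v : vec) (J : 'M[R]_n.+1).

Lemma is_derive_segment H x v (t : R) l : differentiable H (x + t *: v) ->
  is_derive t 1 (fun t => H (x + t *: v) 0 l)
    ((v *m jacobian H (x + t *: v)) 0 l).
Proof.
move=> dH; have dl : differentiable (fun t : R => x + t *: v) t by [].
have dc : differentiable (fun t : R => H (x + t *: v)) t.
  exact: differentiable_comp.
have dcl : differentiable (fun t : R => H (x + t *: v) 0 l) t.
  exact: (differentiable_comp dc (differentiable_coord _ _ _)).
apply: DeriveDef; first exact: diff_derivable.
have dg : 'd (fun t : R => x + t *: v) t 1 = v.
  have -> : (fun t : R => x + t *: v) = cst x + *:%R^~ v by [].
  have D := is_diffD (is_diff_cst x t) (is_diff_scalel t v).
  by rewrite (@diff_val _ _ _ _ _ _ _ D) /= fctE add0r scale1r.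
have dv : derivable (fun t : R => H (x + t *: v)) t 1 by exact: diff_derivable.
have := derive_mx dv; rewrite deriveE // => /rowP/(_ l); rewrite mxE => <-.
have -> : (fun t : R => H (x + t *: v)) = H \o (fun t : R => x + t *: v) by [].
by rewrite diff_comp //= dg /jacobian mul_rV_lin1.
Qed.

(** The intermediate point differs from coordinate to coordinate; uniform continuity of the Jacobian
    replaces all of them by [c]. The base point [c] is not tied to [x] or [x'], since it will be one
    critical point representing a whole cube. The division of [w] by [n.+1] makes up for the factor
    in [mulmx_norm_le]. *)
Lemma mean_value_jacobian H r (w : R) :
  (forall x, differentiable H x) -> continuous (jacobian H) -> 0 < w ->
  exists2 d, 0 < d & forall x x' c, `|c| <= r -> `|x - c| < d -> `|x' - c| < d ->
    `|H x - H x' - (x - x') *m jacobian H c| <= w * `|x - x'|.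
Proof.
move=> dH cJ w0.
have wn0 : 0 < w / n.+1%:R by rewrite divr_gt0.
have [d d0 dP] := compact_uniform (@closed_ball_compact R n.+1 r) cJ wn0.
exists d => // x x' c cr xd x'd; pose v := x - x'.
apply: rV_norm_le => [|l]; first by rewrite mulr_ge0 // ltW.
have dl (t : R) : is_derive t 1 (fun t => H (x' + t *: v) 0 l)
    ((v *m jacobian H (x' + t *: v)) 0 l) by exact: is_derive_segment.
have [|t] := @MVT R (fun t => H (x' + t *: v) 0 l) _ 0 1 ltr01 (fun t _ => dl t).
  by apply: derivable_within_continuous => t _; case: (dl t).
rewrite in_itv /= => /andP[t0 t1].
have xv : x' + v = x by rewrite /v addrC subrK.
rewrite scale1r scale0r addr0 subr0 mulr1 xv => Hxl.
have -> : (H x - H x' - (x - x') *m jacobian H c) 0 l =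
    (v *m (jacobian H (x' + t *: v) - jacobian H c)) 0 l.
  have BE (a b : vec) : (a - b) 0 l = a 0 l - b 0 l by rewrite !mxE.
  by rewrite mulmxBr !BE Hxl.
apply: le_trans (rV_coord_le _ l) _; apply: le_trans (mulmx_norm_le _ _) _.
rewrite ler_wpM2r // -ler_pdivlMl // mulrC distrC ltW //; apply: dP => //.
have -> : c - (x' + t *: v) = - ((1 - t) *: (x' - c) + t *: (x - c)).
  by rewrite /v; apply/rowP => j; rewrite !mxE; ring.
rewrite normrN; apply: le_lt_trans (ler_normD _ _) _.
rewrite normrZ [X in _ + X]normrZ !ger0_norm ?subr_ge0 ?(ltW t0) ?(ltW t1) //.
by apply: convex_lt => //; exact: ltW.
Qed.

(** Row vectors are multiplied by [J] on the right, so [w] is normal to a hyperplane containing the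
    image. Dividing by the largest entry makes coordinate [k] of a vector of this hyperplane a
    combination of the others with coefficients at most 1 in absolute value. *)
Lemma singular_kernel J : \det J = 0 -> exists (w : 'cV[R]_n.+1) k,
  [/\ J *m w = 0, w k 0 = 1 & forall j, `|w j 0| <= 1].
Proof.
rewrite -det_tr => /eqP/det0P[v v0 vJ].
have [k vk] := rV_norm_coord v.
have vk0 : v 0 k != 0 by rewrite -normr_eq0 vk normr_eq0.
exists ((v 0 k)^-1 *: v^T), k; split=> [||j].
- by rewrite -scalemxAr -[J]trmxK -trmx_mul vJ trmx0 scaler0.
- by rewrite !mxE mulVf.
rewrite !mxE normrM normfV mulrC ler_pdivrMr ?normr_gt0 // mul1r vk.
exact: rV_coord_le.
Qed.

Lemma modn_close_eq (a b m : nat) : (a < b + m)%N -> (b < a + m)%N ->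
  a = b %[mod m] -> a = b.
Proof.
wlog ab : a b / (a <= b)%N.
  by move=> wl h1 h2 e; case: (leqP a b) => [|/ltnW] ab; [|symmetry]; apply: wl.
move=> _ h2 /esym/eqP; rewrite eqn_mod_dvd // => /dvdnP[k kE].
by case: k kE => [|k] kE; rewrite ?mulSn in kE; lia.
Qed.

End MeanValue.

Section Sard.
Variables (R : realType) (n : nat).
Local Notation vec := 'rV[R]_n.+1.
Implicit Types (H : vec -> vec) (x y : vec) (r : R).

(** The face where a coordinate equals [r] yields the index [N]; hence [N.+1] values per
    direction. *)
Definition cube_index r (N : nat) x : {ffun 'I_n.+1 -> 'I_N.+1} :=
  [ffun j => inord (Num.truncn ((x 0 j + r) / (2 * r) * N%:R))].

Lemma cube_index_close r (N : nat) x x' : 0 < r -> (0 < N)%N ->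
  `|x| <= r -> `|x'| <= r -> cube_index r N x = cube_index r N x' ->
  `|x - x'| <= 2 * r / N%:R.
Proof.
move=> r0 N0 xr xr' eqc.
have NR : (0 : R) < N%:R by rewrite ltr0n.
have r2 : 0 < 2 * r by rewrite mulr_gt0.
have itv (z : vec) j : `|z : vec| <= r ->
    0 <= (z 0 j + r) / (2 * r) * N%:R <= N%:R.
  move=> zr; have := le_trans (rV_coord_le z j) zr; rewrite ler_norml => /andP[z1 z2].
  rewrite -{3}[N%:R]mul1r ler_pM2r // ler_pdivrMr // mul1r.
  by rewrite mulr_ge0 ?divr_ge0 ?(ltW r2) //=; lra.
have trunc_lt (z : vec) j : `|z : vec| <= r ->
    (Num.truncn ((z 0 j + r) / (2 * r) * N%:R)%R < N.+1)%N.
  move=> zr; have /andP[z1 z2] := itv z j zr.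
  have /andP[t1 _] := truncn_itv z1.
  by rewrite ltnS -(ler_nat R) (le_trans t1).
apply: rV_norm_le => [|j]; first by rewrite divr_ge0 // ltW.
have := congr1 (fun c : {ffun _ -> _} => val (c j)) eqc.
rewrite /= !ffunE !inordK ?trunc_lt // => eqt.
have lt1 : `|(x 0 j + r) / (2 * r) * N%:R - (x' 0 j + r) / (2 * r) * N%:R| <= 1.
  move: eqt (itv x j xr) (itv x' j xr').
  move: (_ / _ * _) (_ / _ * _) => A B eqt /andP[A0 _] /andP[B0 _].
  have /andP[] := truncn_itv A0; have /andP[] := truncn_itv B0.
  by rewrite -eqt -natr1 ler_norml; lra.
have -> : (x - x') 0 j = 2 * r / N%:R *
    ((x 0 j + r) / (2 * r) * N%:R - (x' 0 j + r) / (2 * r) * N%:R).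
  by rewrite !mxE; field; rewrite !gt_eqF.
by rewrite normrM gtr0_norm ?divr_gt0 // ler_piMr // ltW ?divr_gt0.
Qed.

(* Two critical points in a small cube have images that differ, up to a small
   error, by a vector in a fixed hyperplane; so the critical values among the
   points of a fine grid can be encoded by (cube, residues of all coordinates but
   one, parity of the last one), and there are too few codes for all of the
   points of the grid to be critical values. *)
Lemma regular_value_exists H r (e : R) :
  (forall x, differentiable H x) -> continuous (jacobian H) -> 0 < r -> 0 < e ->
  exists y, `|y| < e /\
    forall x, `|x| <= r -> H x = y -> \det (jacobian H x) != 0.
Proof.
move=> dH cJ r0 e0; apply: contrapT => /forallNP noy.
have crit y : exists x, `|y| < e ->
    [/\ `|x| <= r, H x = y & \det (jacobian H x) = 0].
  have [ye|] := ltP `|y| e; last by exists 0.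
  have := noy y; rewrite not_andP => -[//|/existsNP[x]].
  move=> /not_implyP[xr /not_implyP[Hx /negP/negPn/eqP det0]].
  by exists x.
have [X XP] := choice crit.
have ker x : exists wk : 'cV[R]_n.+1 * 'I_n.+1, \det (jacobian H x) = 0 ->
    [/\ jacobian H x *m wk.1 = 0, wk.1 wk.2 0 = 1 & forall j, `|wk.1 j 0| <= 1].
  have [/singular_kernel[w [k wkP]]|ne] := pselect (\det (jacobian H x) = 0).
    by exists (w, k).
  by exists (0, ord0).
have [W WP] := choice ker.
have [K1 K10 JK] : exists2 K1, 0 < K1 & forall x : vec, `|x| <= r ->
    `|jacobian H x| <= K1.
  apply: (compact_upper_bound (f := fun x => `|jacobian H x|)).
    exact: closed_ball_compact.
  move=> x; apply: (@continuous_comp _ _ _ (jacobian H) Num.norm); first exact: cJ.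
  exact: norm_continuous.
pose K := n.+1%:R * K1 + 1.
have K0 : 0 < K by rewrite ltr_wpDl // mulr_ge0 // ltW.
(* Images of points of one cube differ by at most [K * delta], which is less than [C * q] grid
   steps. The choices are not circular: [C] depends on neither [q] nor [N], then [q] fixes [w], and
   [w] fixes [d] and [N]. *)
pose C := (Num.truncn (4 * r * K / e)).+1.
have CK : 4 * r * K / e < C%:R.
  have A0 : 0 <= 4 * r * K / e.
    by rewrite divr_ge0 ?(ltW e0) // !mulr_ge0 // ltW.
  by have /andP[] := truncn_itv A0.
(* There are [(q * N.+1) ^ n.+1] grid points and [N.+1 ^ n.+1 * 2 * (C * q) ^ n] codes; the codes
   are too few once [2 * C ^ n < q]. *)
pose q := (2 * C ^ n).+1.
have qR : (0 : R) < q%:R by rewrite ltr0n.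
(* The bound 1 is the summand 1 of [K]. The other bound keeps the error along the kernel vector
   within one grid step [s], so that parity decides the last coordinate. *)
pose w := Num.min 1 (e / (4 * r * q%:R * n.+1%:R)).
have w0 : 0 < w by rewrite lt_min ltr01 /= divr_gt0 // !mulr_gt0.
have [d d0 dP] := @mean_value_jacobian R n H r w dH cJ w0.
have [N /(_ N (leqnn _))[N0 Nd]] : exists m : nat, forall N : nat, (m <= N)%N ->
    (0 < N)%N /\ N%:R^-1 < d / (2 * r).
  by apply: exists_inv_lt; rewrite divr_gt0 // mulr_gt0.
have NR : (0 : R) < N%:R by rewrite ltr0n.
pose delta := 2 * r / N%:R.
have delta0 : 0 < delta by rewrite divr_gt0 // mulr_gt0.
have deltad : delta < d.
  by rewrite /delta mulrC -ltr_pdivlMr // mulr_gt0.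
pose M := (q * N.+1)%N.
have MR : (0 : R) < M%:R by rewrite ltr0n muln_gt0.
pose s := e / M%:R.
have s0 : 0 < s by rewrite divr_gt0.
have delta_s : delta <= 4 * r * q%:R / e * s.
  have -> : 4 * r * q%:R / e * s = 4 * r / N.+1%:R.
    by rewrite /s /M natrM; field; rewrite !gt_eqF ?ltr0n.
  rewrite /delta ler_pdivrMr // mulrAC ler_pdivlMr ?ltr0n //.
  have N1 : (1 : R) <= N%:R by rewrite ler1n.
  by rewrite -natr1; nra.
pose T := {ffun 'I_n.+1 -> 'I_M}.
pose Y (a : T) : vec := \row_j ((a j)%:R * s).
have Ye a : `|Y a| < e.
  apply: rV_norm_lt => // j; rewrite mxE ger0_norm; last first.
    by apply: mulr_ge0 => //; exact: ltW.
  by rewrite /s mulrA ltr_pdivrMr // mulrC ltr_pM2l // ltr_nat.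
pose Q (a : T) := cube_index r N (X (Y a)).
(* All chosen preimages in a cube are compared with the same critical point, so the kernel vector
   and the pivot depend on the cube alone. *)
pose xc i : vec := if [pick b | Q b == i] is Some c then X (Y c) else 0.
have xcP : forall a, [/\ `|xc (Q a)| <= r, \det (jacobian H (xc (Q a))) = 0 &
    cube_index r N (xc (Q a)) = Q a].
  move=> a; rewrite /xc; case: pickP => [b /eqP Qb|/(_ a)]; last by rewrite eqxx.
  by have [? ? ?] := XP _ (Ye b).
pose piv i := (W (xc i)).2.
have Cq0 : (0 < C * q)%N by [].
pose code (a : T) : {ffun 'I_n.+1 -> 'I_N.+1} * ('I_2 * {ffun 'I_n -> 'I_(C * q)}) :=
  (Q a, (Ordinal (ltn_pmod (a (piv (Q a))) (isT : 0 < 2)%N),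
    [ffun j => Ordinal (ltn_pmod (a (lift (piv (Q a)) j)) Cq0)])).
have code_inj : injective code.
  move=> a b; rewrite /code => -[eqQ]; rewrite -eqQ => par res.
  have [ar Ha _] := XP _ (Ye a); have [br Hb _] := XP _ (Ye b).
  have [cr cdet cQ] := xcP a; set c := xc (Q a) in cr cdet cQ.
  have [Jw wk wle] := WP c cdet; rewrite -/(piv (Q a)) in wk.
  set k := piv (Q a) in wk par res; set wv := (W c).1 in Jw wk wle.
  have ac : `|X (Y a) - c| <= delta by apply: cube_index_close => //; rewrite cQ.
  have bc : `|X (Y b) - c| <= delta.
    by apply: cube_index_close => //; rewrite cQ eqQ.
  have ab : `|X (Y a) - X (Y b)| <= delta by apply: cube_index_close.
  have := dP _ _ c cr (le_lt_trans ac deltad) (le_lt_trans bc deltad).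
  rewrite Ha Hb; set D := _ - _ - _ => Dle.
  have Dw : `|D| <= w * delta by apply: le_trans Dle _; rewrite ler_pM2l.
  have Yab : `|Y a - Y b| <= K * delta.
    have -> : Y a - Y b = D + (X (Y a) - X (Y b)) *m jacobian H c.
      by rewrite /D subrK.
    apply: le_trans (ler_normD _ _) _; rewrite /K mulrDl addrC lerD //.
      apply: le_trans (mulmx_norm_le _ _) _; rewrite ler_pM ?mulr_ge0 //.
      by rewrite ler_wpM2l // JK.
    by apply: le_trans Dw _; rewrite ler_wpM2r ?(ltW delta0) // /w ge_min lexx.
  have Yj j : (Y a - Y b) 0 j = ((a j)%:R - (b j)%:R) * s by rewrite !mxE mulrBl.
  have close j : `|(a j)%:R - (b j)%:R : R| < (C * q)%:R.
    have := le_trans (rV_coord_le _ j) Yab.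
    rewrite Yj normrM (gtr0_norm s0) -ler_pdivlMr // => /le_lt_trans; apply.
    rewrite ltr_pdivrMr //.
    apply: le_lt_trans (_ : K * (4 * r * q%:R / e * s) < _).
      by rewrite ler_pM2l.
    rewrite mulrA ltr_pM2r // natrM.
    have -> : K * (4 * r * q%:R / e) = 4 * r * K / e * q%:R by ring.
    by rewrite ltr_pM2r.
  have eq_of_close (m : nat) j : `|(a j)%:R - (b j)%:R : R| < m%:R ->
      a j = b j %[mod m] -> a j = b j.
    rewrite ltr_norml => /andP[h1 h2] h; apply: ord_inj.
    by apply: (@modn_close_eq _ _ m) => //; rewrite -(ltr_nat R) natrD; lra.
  have eq_off j : j != k -> a j = b j.
    move=> jk; case: (unliftP k j) jk => [j' ->|->]; last by rewrite eqxx.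
    move=> _; apply: (eq_of_close _ _ (close _)).
    by have := congr1 (fun h : {ffun _ -> _} => val (h j')) res; rewrite /= !ffunE.
  have eq_k : a k = b k.
    apply: (eq_of_close 2); last exact: par.
    (* The kernel vector annihilates the linear part, and the coordinates other than [k] already
       agree: only the difference in coordinate [k] is left to face the error bound. *)
    have DwE : (D *m wv) 0 0 = ((a k)%:R - (b k)%:R) * s.
      rewrite /D mulmxBl -mulmxA Jw mulmx0 subr0 mxE (bigD1 k) //= Yj wk mulr1.
      by rewrite big1 ?addr0 // => j /eq_off abj; rewrite Yj abj subrr !mul0r.
    have : `|(D *m wv) 0 0| <= n.+1%:R * (w * delta).
      rewrite mxE; apply: le_trans (ler_norm_sum _ _ _) _.
      have -> : n.+1%:R * (w * delta) = \sum_(j < n.+1) (w * delta).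
        by rewrite sumr_const card_ord mulr_natl.
      apply: ler_sum => j _; rewrite normrM -[leRHS]mulr1 ler_pM //.
      exact: le_trans (rV_coord_le _ _) Dw.
    rewrite DwE normrM (gtr0_norm s0) -ler_pdivlMr // => /le_lt_trans; apply.
    rewrite ltr_pdivrMr //.
    have wle' : w <= e / (4 * r * q%:R * n.+1%:R) by rewrite /w ge_min lexx orbT.
    apply: (@le_lt_trans _ _ s); last by rewrite ltr_pMl // ltr1n.
    apply: le_trans (_ : n.+1%:R * (e / (4 * r * q%:R * n.+1%:R) *
      (4 * r * q%:R / e * s)) <= _).
      by rewrite ler_wpM2l // ler_pM // ltW.
    have -> // : n.+1%:R * (e / (4 * r * q%:R * n.+1%:R) *
      (4 * r * q%:R / e * s)) = s.
    by field; rewrite !gt_eqF ?ltr0n.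
  by apply/ffunP => j; have [->|/eq_off] := eqVneq j k.
have := leq_card code code_inj.
rewrite !card_prod !card_ffun !card_ord /M !expnMn mulnC leq_pmul2l ?expn_gt0 //.
rewrite expnS mulnA leq_pmul2r ?expn_gt0 //.
by rewrite /q ltnn.
Qed.

End Sard.

(** * Smooth approximation *)

Section MatrixValued.
Variable R : realType.

Lemma mx_valued_continuous (T : topologicalType) m n (M : T -> 'M[R]_(m, n)) :
  (forall i j, continuous (fun x => M x i j)) -> continuous M.
Proof.
move=> cM x U [P MP PU].
have nM (i : 'I_m) : \forall y \near x, forall j, P i j (M y i j).
  by apply: filter_forall => j; exact: (cM i j x) (MP i j).
have nM2 := filter_forall _ nM.
apply: (@filterS _ _ (nbhs_filter x) _ _ _ (nM2 (nbhs_filter x))) => y My.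
by apply: PU => i j; exact: My.
Qed.

Lemma row_valued_continuous (T : topologicalType) n (h : 'I_n -> T -> R) :
  (forall i, continuous (h i)) -> continuous (fun x => \row_i h i x : 'rV[R]_n).
Proof.
move=> ch; apply: mx_valued_continuous => i j.
by rewrite (_ : (fun x => _) = h j) //; apply/funext => x; rewrite mxE.
Qed.

End MatrixValued.

Section C1Functions.
Variables (R : realType) (V : normedModType R).
Implicit Types (h g : V -> R) (x v : V).

(** Continuity of the differential is asked direction by direction; on row vectors this is
    continuity of the entries of the Jacobian. *)
Definition C1 h := (forall x, differentiable h x) /\
  forall v, continuous (fun x => 'd h x v).

Lemma C1_cst (c : R) : C1 (cst c).
Proof.
split=> [x|v]; first exact: differentiable_cst.
rewrite (_ : (fun x => _) = cst 0) => [|]; first exact: cst_continuous.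
by apply/funext => x; rewrite diff_cst.
Qed.

Lemma C1_add h g : C1 h -> C1 g -> C1 (h \+ g).
Proof.
move=> [dh ch] [dg cg]; split=> [x|v]; first exact: differentiableD.
rewrite (_ : (fun x => _) = (fun x => 'd h x v + 'd g x v)).
  by move=> x; apply: cvgD; [exact: (ch v x)|exact: (cg v x)].
by apply/funext => x; rewrite diffD.
Qed.

Lemma C1_sum (I : Type) (s : seq I) (P : pred I) (h : I -> V -> R) :
  (forall i, C1 (h i)) -> C1 (fun x => \sum_(i <- s | P i) h i x).
Proof.
move=> Ch; elim: s => [|i s IH].
  rewrite (_ : (fun x => _) = cst 0); first exact: C1_cst.
  by apply/funext => x; rewrite big_nil.
have [Pi|Pi] := boolP (P i); last first.
  rewrite (_ : (fun x => _) = (fun x => \sum_(i <- s | P i) h i x)) //.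
  by apply/funext => x; rewrite big_cons (negbTE Pi).
rewrite (_ : (fun x => _) = h i \+ (fun x => \sum_(i <- s | P i) h i x)).
  exact: (C1_add (Ch i) IH).
by apply/funext => x; rewrite big_cons Pi.
Qed.

Lemma C1_comp (g dg : R -> R) h : (forall t : R, is_derive t 1 g (dg t)) ->
  continuous dg -> C1 h -> C1 (g \o h).
Proof.
move=> Dg cdg [dh ch].
have dfg t : differentiable g t.
  by apply/derivable1_diffP; case: (Dg t).
split=> [x|v]; first exact: differentiable_comp.
rewrite (_ : (fun x => _) = (fun x => 'd h x v * dg (h x))).
  move=> x; apply: cvgM; first exact: (ch v x).
  apply: (@continuous_comp _ _ _ h dg); last exact: cdg.
  exact: differentiable_continuous.
apply/funext => x; rewrite diff_comp //= diff1E // derive1E.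
by have [_ ->] := Dg (h x).
Qed.

End C1Functions.

Section C1Rows.
Variables (R : realType) (n : nat).
Local Notation vec := 'rV[R]_n.

Lemma C1_rows (h : 'I_n -> vec -> R) : (forall i, C1 (h i)) ->
  let H := fun x => \row_i h i x : vec in
  (forall x, differentiable H x) /\ continuous (jacobian H).
Proof.
move=> Ch H.
have dH x : differentiable H x.
  have -> : H = \sum_(i < n) (fun x => h i x *: delta_mx 0 i).
    apply/funext => y; rewrite fct_sumE; apply/rowP => j.
    rewrite mxE summxE (bigD1 j) //= !mxE !eqxx mulr1 big1 ?addr0 // => i ij.
    by rewrite !mxE eqxx eq_sym (negbTE ij) mulr0.
  by apply: differentiable_sum => i; apply: differentiableZl; case: (Ch i).
split=> //; apply: mx_valued_continuous => j i.
rewrite (_ : (fun x => _) = (fun x => 'd (h i) x (delta_mx 0 j))).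
  by case: (Ch i) => _; apply.
apply/funext => x.
have -> : jacobian H x j i = ((delta_mx 0 j : vec) *m jacobian H x) 0 i.
  by rewrite -rowE [RHS]mxE.
rewrite -deriveEjacobian // derive_mx; last exact: diff_derivable.
rewrite mxE -deriveE; last by case: (Ch i).
by congr ('D_ _ _ _); apply/funext => y; rewrite mxE.
Qed.

End C1Rows.

Section RegularizedPower.
Variables (R : realType) (p : R).
Hypothesis p1 : 1 < p.

(* At [e = 0] this is [|t|^(p-2) t], with the value 0 at [t = 0]. *)
Definition smooth_power (t e : R) : R := (t ^+ 2 + e ^+ 2) `^ ((p - 2) / 2) * t.

Lemma smooth_power0 t : smooth_power t 0 = `|t| `^ (p - 2) * t.
Proof.
rewrite /smooth_power expr0n addr0; congr (_ * t).
rewrite -(ger0_norm (sqr_ge0 t)) normrX -powR_mulrn // -powRrM.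
by congr (_ `^ _); field.
Qed.

Lemma powR_continuous_at (a x : R) : 0 < x -> {for x, continuous (fun y : R => y `^ a)}.
Proof.
move=> x0; apply: differentiable_continuous; apply/derivable1_diffP.
by case: (is_derive1_powR a x0).
Qed.

(** Bounding [|t|] by the square root of [t^2 + e^2] turns the exponent [(p - 2) / 2], negative for
    [p < 2], into the positive [(p - 1) / 2]. This gives continuity at the origin. *)
Lemma smooth_power_norm_le t e :
  `|smooth_power t e| <= (t ^+ 2 + e ^+ 2) `^ ((p - 1) / 2).
Proof.
have s0 : 0 <= t ^+ 2 + e ^+ 2 by rewrite addr_ge0 ?sqr_ge0.
have [->|t0] := eqVneq t 0; first by rewrite /smooth_power mulr0 normr0 powR_ge0.
have s1 : 0 < t ^+ 2 + e ^+ 2.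
  by rewrite ltr_wpDr ?sqr_ge0 // exprn_even_gt0.
have -> : (p - 1) / 2 = (p - 2) / 2 + 2^-1 by field.
rewrite powRD; last by rewrite (gt_eqF s1) implybT.
rewrite normrM ger0_norm ?powR_ge0 // ler_wpM2l ?powR_ge0 //.
by rewrite powR12_sqrt // -(sqrtr_sqr t) ler_sqrt // lerDl sqr_ge0.
Qed.

Lemma smooth_power_continuous :
  continuous (fun z : R * R => smooth_power z.1 z.2).
Proof.
have cs : continuous (fun z : R * R => z.1 ^+ 2 + z.2 ^+ 2).
  move=> z; apply: cvgD.
    by apply: (@cvgM _ _ _ _ fst fst); exact: cvg_fst.
  by apply: (@cvgM _ _ _ _ snd snd); exact: cvg_snd.
move=> z; have [z0|z0] := eqVneq (z.1 ^+ 2 + z.2 ^+ 2) 0.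
  have [t0 e0] : z.1 = 0 /\ z.2 = 0.
    move: z0 => /eqP; rewrite paddr_eq0 ?sqr_ge0 // !sqrf_eq0.
    by move=> /andP[/eqP ? /eqP ?].
  have sp0 : smooth_power z.1 z.2 = 0 by rewrite /smooth_power t0 mulr0.
  apply/cvgrPdist_lt => e epos; rewrite sp0.
  have a0 : 0 < (p - 1) / 2 by rewrite divr_gt0 // subr_gt0.
  pose d := e `^ ((p - 1) / 2)^-1.
  have d0 : 0 < d by rewrite powR_gt0.
  have := cs z; move=> /cvgrPdist_lt/(_ _ d0); rewrite z0 => nd.
  have small (y : R * R) : `|0 - (y.1 ^+ 2 + y.2 ^+ 2)| < d ->
      `|0 - smooth_power y.1 y.2| < e.
    rewrite sub0r normrN ger0_norm ?addr_ge0 ?sqr_ge0 // => yd.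
    rewrite sub0r normrN; apply: le_lt_trans (smooth_power_norm_le _ _) _.
    have := gt0_ltr_powR a0 _ _ yd.
    rewrite /d -powRrM mulVf ?gt_eqF // powRr1 ?(ltW epos) //; apply.
      by rewrite nnegrE addr_ge0 ?sqr_ge0.
    by rewrite nnegrE powR_ge0.
  exact: (@filterS _ _ (nbhs_filter z) _ _ small nd).
have s1 : 0 < z.1 ^+ 2 + z.2 ^+ 2 by rewrite lt_def z0 addr_ge0 ?sqr_ge0.
apply: cvgM; last exact: cvg_fst.
apply: (@continuous_comp _ _ _ (fun z : R * R => z.1 ^+ 2 + z.2 ^+ 2)
  (fun y : R => y `^ ((p - 2) / 2))); first exact: cs.
exact: powR_continuous_at.
Qed.

Lemma smooth_power_uniform (T eta : R) : 0 < eta ->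
  exists2 e, 0 < e & forall t, `|t| <= T ->
    `|smooth_power t e - smooth_power t 0| < eta.
Proof.
move=> eta0; pose A := `[- T, T]%classic `*` [set (0 : R)].
have cA : compact A.
  by apply: compact_setX; [exact: segment_compact|exact: compact_set1].
have [d d0 dP] := compact_uniform cA smooth_power_continuous eta0.
exists (d / 2) => [|t tT]; first by rewrite divr_gt0.
rewrite distrC; apply: (dP (t, 0) (t, d / 2)).
  by split=> //=; rewrite in_itv /= -ler_norml.
rewrite prod_normE /= subrr sub0r normr0 normrN.
by rewrite gt_max d0 gtr0_norm; lra.
Qed.

Definition smooth_power_deriv (e t : R) : R :=
  (p - 2) / 2 * (t ^+ 2 + e ^+ 2) `^ ((p - 2) / 2 - 1) * (2 * t) * t
    + (t ^+ 2 + e ^+ 2) `^ ((p - 2) / 2).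

Lemma is_derive_smooth_power (e t : R) : 0 < e ->
  is_derive t 1 (smooth_power ^~ e) (smooth_power_deriv e t).
Proof.
move=> e0; have s0 : 0 < t ^+ 2 + e ^+ 2.
  by rewrite ltr_wpDl ?sqr_ge0 // exprn_gt0.
have Ds : is_derive t 1 (fun t : R => t ^+ 2 + e ^+ 2) (2 * t).
  by apply: is_derive_eq; rewrite addr0 [_%:A]mulr1 -mulr2n mulr_natl.
have Dp := @is_derive1_comp _ (fun y : R => y `^ ((p - 2) / 2))
  (fun t : R => t ^+ 2 + e ^+ 2) t _ _ (is_derive1_powR ((p - 2) / 2) s0) Ds.
have DM := is_deriveM Dp (is_derive_id t 1).
by apply: (is_derive_eq DM); rewrite /= [_%:A]mulr1 addrC [_ *: _]mulrC.
Qed.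

Lemma smooth_power_deriv_continuous (e : R) : 0 < e ->
  continuous (smooth_power_deriv e).
Proof.
move=> e0 t; have s0 : 0 < t ^+ 2 + e ^+ 2.
  by rewrite ltr_wpDl ?sqr_ge0 // exprn_gt0.
have cs : {for t, continuous (fun t : R => t ^+ 2 + e ^+ 2)}.
  by apply: cvgD; [apply: cvgM; exact: cvg_id|exact: cvg_cst].
have cp a : {for t, continuous (fun t : R => (t ^+ 2 + e ^+ 2) `^ a)}.
  apply: (@continuous_comp _ _ _ (fun t : R => t ^+ 2 + e ^+ 2)
    (fun y : R => y `^ a)); first exact: cs.
  exact: powR_continuous_at.
apply: cvgD; last exact: cp.
apply: cvgM; last exact: cvg_id.
apply: cvgM; last by apply: cvgM; [exact: cvg_cst|exact: cvg_id].
by apply: cvgM; [exact: cvg_cst|exact: cp].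
Qed.

End RegularizedPower.

Section JacobianTranslation.
Variables (R : realType) (n : nat).
Local Notation vec := 'rV[R]_n.

Lemma row_jacobian (H : vec -> vec) x (j : 'I_n) : differentiable H x ->
  row j (jacobian H x) = 'D_(delta_mx 0 j : vec) H x.
Proof. by move=> dH; rewrite (deriveEjacobian _ dH) rowE. Qed.

Lemma jacobian_subr_cst (H : vec -> vec) y : (forall x, differentiable H x) ->
  jacobian (fun x => H x - y) = jacobian H.
Proof.
move=> dH; apply/funext => x; apply/row_matrixP => j.
have dG : differentiable (fun x => H x - y) x by apply: differentiableB.
apply: etrans (row_jacobian j dG) _; apply/esym.
apply: etrans (row_jacobian j (dH x)) _; apply/esym.
have dv : derivable H x (delta_mx 0 j : vec) by exact: diff_derivable.
apply: etrans (deriveB dv (derivable_cst y x (delta_mx 0 j : vec))) _.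
by rewrite derive_cst subr0.
Qed.

End JacobianTranslation.

Section DegreeOfLinearHomotopic.
Variables (R : realType) (n : nat).
Local Notation vec := 'rV[R]_n.

(** The set from which [xget] chooses is inhabited: subtract from a smooth approximation [H] a small
    regular value [y], each error being below half of the minimum of [|F|] on the sphere. Every
    member of the set is the sign of [\det A]. *)
Lemma brouwer_degree_linear_homotopic (F : vec -> vec) (A : 'M[R]_n) (r : R) :
  (0 < n)%N -> 0 < r -> continuous F -> \det A != 0 ->
  (forall z s, `|z| = r -> 0 <= s <= 1 -> (1 - s) *: F z + s *: (z *m A) != 0) ->
  (forall eta, 0 < eta -> exists2 H : vec -> vec,
     (forall x, differentiable H x) /\ continuous (jacobian H) &
     forall x, `|x| <= r -> `|H x - F x| < eta) ->
  degree_defined F (open_ball r) 0 /\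
  brouwer_degree F (open_ball r) 0 = sgz (\det A).
Proof.
case: n F A => // m F A _ r0 cF dA hom approx.
have FB : {within closure (open_ball r), continuous F}.
  exact: continuous_subspaceT.
have F0 x : `|x| = r -> F x != 0.
  move=> xr; have := hom x 0 xr.
  by rewrite subr0 scale1r scale0r addr0 lexx ler01; apply.
have defined : degree_defined F (open_ball r) 0.
  split=> // [||x]; first exact: open_open_ball.
    exists r; split=> [|M rM x /ltW xr /=]; first exact: num_real.
    by rewrite (le_trans xr) ?ltW.
  by rewrite frontier_open_ball //; exact: F0.
split=> //.
have [eta eta0 Feta] : exists2 eta, 0 < eta & forall x, `|x| = r -> eta <= `|F x|.
  apply: (@compact_lower_bound R _ [set x | `|x| = r] (fun x => `|F x|)).
  - have -> : [set x : 'rV[R]_m.+1 | `|x| = r] =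
        [set x | `|x| <= r] `&` [set x | `|x| = r].
      by apply/seteqP; split=> x /=; [move=> ->|case].
    apply: compact_closedI; first exact: closed_ball_compact.
    apply: (@preimage_closed _ _ (fun x : 'rV[R]_m.+1 => `|x|) [set t | t = r]).
      by move=> ? _; exact: norm_continuous.
    exact: closed_eq.
  - by move=> x; apply: (@continuous_comp _ _ _ F Num.norm);
      [exact: cF|exact: norm_continuous].
  by move=> x /= xr; rewrite normr_gt0 F0.
have eta2 : 0 < eta / 2 by rewrite divr_gt0.
have [H [dH cJ] HF] := approx _ eta2.
have [y [ye yreg]] := regular_value_exists dH cJ r0 eta2.
pose G (x : 'rV[R]_m.+1) : 'rV[R]_m.+1 := H x - y.
have dG x : differentiable G x by apply: differentiableB.
have JG : jacobian G = jacobian H by exact: (jacobian_subr_cst y dH).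
have regG : regular_approximation F (open_ball r) 0 G.
  split.
  - apply: continuous_subspaceT => x; exact: differentiable_continuous.
  - by move=> x _; split; [exact: dG|have := cJ x; rewrite -JG].
  - move=> x /ltW xr /eqP; rewrite subr_eq0 => /eqP Hxy.
    by have := yreg x xr Hxy; rewrite -JG.
  move=> x z; rewrite (closure_open_ball _ r0) (frontier_open_ball _ r0) => xr zr.
  rewrite subr0; apply: lt_le_trans (Feta z zr).
  have -> : G x - F x = (H x - F x) - y by rewrite /G addrAC.
  have := HF x xr; have := ler_normB (H x - F x) y; lra.
rewrite /brouwer_degree.
have := @xgetPex _ 0 [set d : int | exists2 G,
  regular_approximation F (open_ball r) 0 G & d = signed_count G (open_ball r) 0].
case=> [|G' regG' ->]; first by exists (signed_count G (open_ball r) 0), G.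
exact: (signed_count_linear_homotopic r0 FB regG').
Qed.

End DegreeOfLinearHomotopic.

(** * A priori estimates *)

Section CutSums.
Variables (R : realType) (V : finType) (E : rel V) (phi : R -> R).
Hypothesis symE : symmetric E.
Hypothesis phiN : forall t, phi (- t) = - phi t.
Implicit Types (v : V -> R) (S : pred V).

(** For [phi t = |t|^(p-2) t] this is minus the p-Laplacian. [phi] is kept general because the case
    [lambda < 0] also uses the identity on the complete graph. *)
Definition flux v x : R := \sum_(y | E x y) phi (v x - v y).

(** Discrete divergence theorem: an edge inside [S] is counted from both ends, with opposite
    signs. *)
Lemma sum_flux v S : \sum_(x | S x) flux v x =
  \sum_(x | S x) \sum_(y | E x y && ~~ S y) phi (v x - v y).
Proof.
rewrite /flux (eq_bigr (fun x => \sum_(y | E x y && S y) phi (v x - v y) +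
  \sum_(y | E x y && ~~ S y) phi (v x - v y))) => [|x _]; last exact: bigID.
rewrite big_split /=; set I := \sum_(x | S x) \sum_(y | E x y && S y) _.
suff /eqP : I = - I.
  by rewrite -addr_eq0 -mulr2n mulrn_eq0 /= => /eqP ->; rewrite add0r.
rewrite {1}/I (exchange_big_dep S) /= => [|x y _ /andP[]//].
rewrite -sumrN; apply: eq_bigr => y Sy; rewrite -sumrN.
apply: eq_big => [x|x _]; first by rewrite Sy andbT symE andbC.
by rewrite -phiN opprB.
Qed.

Lemma sum_flux0 v : \sum_x flux v x = 0.
Proof.
by rewrite sum_flux big1 // => x _; rewrite big_pred0 // => y; rewrite andbF.
Qed.

Hypothesis phi_ge0 : forall t, 0 <= t -> 0 <= phi t.

Lemma flux_max v x : (forall y, v y <= v x) -> 0 <= flux v x.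
Proof. by move=> vx; apply: sumr_ge0 => y _; rewrite phi_ge0 // subr_ge0. Qed.

Lemma flux_min v x : (forall y, v x <= v y) -> flux v x <= 0.
Proof.
move=> vx; apply: sumr_le0 => y _.
by rewrite -opprB phiN oppr_le0 phi_ge0 // subr_ge0.
Qed.

(** Every edge leaving a superlevel set descends, so no term of the boundary sum is negative and a
    single edge bounds it from below. *)
Lemma upper_cut_flux_ge v x0 y0 : E x0 y0 -> v y0 < v x0 ->
  phi (v x0 - v y0) <= \sum_(x | v x0 <= v x) flux v x.
Proof.
move=> Exy lt; rewrite (sum_flux v (fun x => v x0 <= v x)).
have term x y : v x0 <= v x -> E x y && ~~ (v x0 <= v y) -> 0 <= phi (v x - v y).
  by move=> Sx /andP[_]; rewrite -ltNge => Sy; apply: phi_ge0; lra.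
rewrite (bigD1 x0) //= (bigD1 y0) /=; last by rewrite Exy -ltNge.
rewrite -addrA lerDl addr_ge0 //.
  by apply: sumr_ge0 => y /andP[Sy _]; exact: term.
apply: sumr_ge0 => x /andP[Sx _]; apply: sumr_ge0 => y; exact: term.
Qed.

End CutSums.

Section Estimates.
Variables (R : realType) (V : finType) (E : rel V) (p : R).
Hypothesis p1 : 1 < p.
Hypothesis symE : symmetric E.
Hypothesis conE : forall x y : V, connect E x y.
Implicit Types (v f : V -> R) (r s : R).

Lemma path_drop_le v g x (q : seq V) :
  (forall a b, E a b -> v a - v b <= g) -> path E x q ->
  v x - v (last x q) <= (size q)%:R * g.
Proof.
move=> Eg; elim: q x => [|y q IH] x /=; first by rewrite subrr mul0r.
move=> /andP[/Eg xy /IH yq]; rewrite -natr1; lra.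
Qed.

(** A simple path has fewer than [#|V|] edges, so its drops cannot all be smaller than the total
    divided by [#|V|]. *)
Lemma steep_edge v x1 x2 : v x2 < v x1 ->
  exists x y, E x y /\ (v x1 - v x2) / #|V|%:R <= v x - v y.
Proof.
move=> lt; set g := _ / _.
have n0 : (0 : R) < #|V|%:R by rewrite ltr0n; apply/card_gt0P; exists x1.
have [//|noE] := pselect (exists x y, E x y /\ g <= v x - v y).
have Eg a b : E a b -> v a - v b <= g.
  move=> Eab; rewrite leNgt; apply/negP => /ltW gab; apply: noE.
  by exists a, b.
have /connectP[q0 pq0 lq0] := conE x1 x2.
case/shortenP: pq0 lq0 => q pq uq _ lq.
have := path_drop_le Eg pq; rewrite -lq.
have qn : (size q < #|V|)%N.
  by have := max_card (mem (x1 :: q)); rewrite (card_uniqP uq).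
have gn : v x1 - v x2 = g * #|V|%:R by rewrite /g divfK // gt_eqF.
have g0 : 0 < g by rewrite divr_gt0 // subr_gt0.
by rewrite {1}gn mulrC ler_pM2r // ler_nat leqNgt qn.
Qed.

Definition phi (t : R) := smooth_power p t 0.

Lemma phiN t : phi (- t) = - phi t.
Proof. by rewrite /phi !smooth_power0 normrN mulrN. Qed.

Lemma phi_powR t : 0 <= t -> phi t = t `^ (p - 1).
Proof.
rewrite /phi smooth_power0 le_eqVlt => /orP[/eqP <-|t0].
  by rewrite mulr0 powR0 // gt_eqF // subr_gt0.
rewrite gtr0_norm // -[X in _ * X]powRr1 ?ltW // -powRD; last first.
  by rewrite (gt_eqF t0) implybT.
by congr (_ `^ _); ring.
Qed.

Lemma phi_ge0 t : 0 <= t -> 0 <= phi t.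
Proof. by move=> t0; rewrite phi_powR // powR_ge0. Qed.

Definition nonlin (t : R) := expR t * (expR t - 1).

Lemma nonlin_ge t : - (1 / 4) <= nonlin t.
Proof. by rewrite /nonlin; have := sqr_ge0 (expR t - 1 / 2); rewrite expr2; lra. Qed.

Lemma nonlin_le0 t : t <= 0 -> nonlin t <= 0.
Proof.
by move=> t0; rewrite pmulr_rle0 ?expR_gt0 // subr_le0 -expR0 ler_expR.
Qed.

Lemma nonlin_ge_id t : 0 <= t -> t <= nonlin t.
Proof.
move=> t0; have := expR_ge1Dx t; have : 1 <= expR t by rewrite -expR0 ler_expR.
by rewrite /nonlin; nra.
Qed.

Lemma sum_cond_bounds f (P : pred V) :
  - (\sum_x `|f x|) <= \sum_(x | P x) f x <= \sum_x `|f x|.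
Proof.
rewrite -ler_norml; apply: le_trans (ler_norm_sum _ _ _) _.
by rewrite [leRHS](bigID P) /= lerDl sumr_ge0.
Qed.

Lemma sum_nonlin_ge v (P : pred V) :
  - (#|V|%:R / 4) <= \sum_(x | P x) nonlin (v x).
Proof.
apply: (@le_trans _ _ (\sum_(x | P x) - (1 / 4))).
  rewrite sumr_const mulNrn lerN2 -[leLHS]mulr_natl mul1r.
  by rewrite ler_wpM2r // ler_nat max_card.
by apply: ler_sum => x _; exact: nonlin_ge.
Qed.

Lemma abs_le_sum f x : `|f x| <= \sum_x `|f x|.
Proof. by rewrite (bigD1 x) //= lerDl sumr_ge0. Qed.

Definition residual (lambda : R) f v x :=
  flux E phi v x + lambda * nonlin (v x) + f x.

(** The least value of [nonlin] is [- 1 / 4], whence the first summand. Of the two sums of [|f|],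
    one absorbs [f] itself, the other the term [s * v] of the homotopy for [lambda > 0]. *)
Definition f_bound (lambda : R) f : R :=
  #|V|%:R * (`|lambda| / 4 + 2 * \sum_x `|f x|).

Implicit Types (lambda : R).

(* A large oscillation forces a steep edge, and the flux through the level set
   cut there outweighs all of the bounded terms. *)
Lemma steep_cut lambda r f v x1 x2 :
  0 < r -> f_bound lambda f < (r / #|V|%:R) `^ (p - 1) -> r <= v x1 - v x2 ->
  exists x y, [/\ v y < v x, (v x1 - v x2) / #|V|%:R <= v x - v y &
    f_bound lambda f < \sum_(z | v x <= v z) flux E phi v z].
Proof.
move=> r0 rp rv; have lt : v x2 < v x1 by lra.
have n0 : (0 : R) < #|V|%:R by rewrite ltr0n; apply/card_gt0P; exists x1.
have [x [y [Exy gxy]]] := steep_edge lt.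
have rg : r / #|V|%:R <= v x - v y.
  by apply: le_trans gxy; rewrite ler_pM2r // invr_gt0.
have rn0 : 0 < r / #|V|%:R by rewrite divr_gt0.
exists x, y; split=> //; first by lra.
apply: lt_le_trans rp _.
apply: le_trans (upper_cut_flux_ge symE phiN phi_ge0 Exy _); last by lra.
rewrite phi_powR; last by lra.
apply: ge0_ler_powR => //; rewrite ?nnegrE ?subr_ge0 ?ltW //; lra.
Qed.

(** At a point of height [r] all terms but [f] are nonnegative, and [lambda * nonlin r] outweighs
    [f]. If the height is [- r], either [v <= 0] everywhere and the sum over [V] is negative, or the
    oscillation exceeds [r] and the sum over a steep superlevel set is positive. *)
Lemma pos_homotopy_nonzero lambda r f v s : 0 < r ->
  \sum_x `|f x| < `|lambda| * r ->
  f_bound lambda f < (r / #|V|%:R) `^ (p - 1) ->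
  0 < lambda -> \sum_x f x < 0 ->
  (forall x, `|v x| <= r) -> (exists x, `|v x| = r) -> 0 <= s <= 1 ->
  ~ (forall x, (1 - s) * residual lambda f v x + s * v x = 0).
Proof.
move=> r0 lr rp l0 sf vr [x0 vx0] /andP[s0 s1] Z.
have F1 : 0 <= \sum_x `|f x| by exact: sumr_ge0.
rewrite gtr0_norm // in lr.
have {}s1 : s < 1.
  rewrite lt_neqAle s1 andbT; apply/eqP => s1'.
  have := Z x0; rewrite s1' subrr mul0r add0r mul1r => v0.
  by move: vx0; rewrite v0 normr0; lra.
have fx0 := abs_le_sum f x0; have := fx0; rewrite ler_norml => /andP[fl fu].
have bnd x : - r <= v x <= r by rewrite -ler_norml.
have := Z x0; rewrite /residual.
case: (lerP 0 (v x0)) => vx0s.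
  have vE : v x0 = r by rewrite -vx0 ger0_norm.
  have := @flux_max _ _ E _ phi_ge0 v x0.
  have vm y : v y <= v x0 by rewrite vE; have := bnd y; lra.
  move=> /(_ vm) fl0; have := nonlin_ge_id (ltW r0); rewrite vE => nl.
  move: fl0; move: (flux _ _ _ _) (nonlin r) nl => F e re F0.
  have : lambda * r <= lambda * e by rewrite ler_pM2l.
  by nra.
have vE : v x0 = - r by rewrite -vx0 ltr0_norm // opprK.
have vm y : v x0 <= v y by rewrite vE; have := bnd y; lra.
have fl0 := @flux_min _ _ E _ phiN phi_ge0 v x0 vm.
have nr : - r <= 0 by lra.
have := nonlin_le0 nr; rewrite vE => nl Zx0.
(* At the minimum only [f] can balance [- s * r]. This makes the linear term comparable with
   [1 - s], however close [s] is to 1. *)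
have sr : s * r <= (1 - s) * \sum_x `|f x|.
  have : lambda * nonlin (- r) <= 0 by rewrite pmulr_rle0.
  move: Zx0 fl0; move: (flux _ _ _ _) (lambda * _) => F e; nra.
have [x1 x1max] : exists x1, forall y, v y <= v x1.
  by have [x1 _ H] := @arg_maxP _ _ _ x0 predT v isT; exists x1 => y; exact: H.
have sumZ (P : pred V) : (1 - s) * (\sum_(x | P x) flux E phi v x +
    lambda * \sum_(x | P x) nonlin (v x) + \sum_(x | P x) f x) +
    s * \sum_(x | P x) v x = 0.
  transitivity (\sum_(x | P x) ((1 - s) * residual lambda f v x + s * v x)).
    by rewrite /residual big_split -!mulr_sumr !big_split -mulr_sumr.
  by apply: big1 => x _; exact: Z.
case: (lerP (v x1) 0) => M0.
  have := sumZ predT; rewrite (sum_flux0 symE phiN).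
  have : \sum_x nonlin (v x) <= 0.
    by apply: sumr_le0 => x _; apply: nonlin_le0; exact: le_trans M0.
  have : \sum_x v x <= 0 by apply: sumr_le0 => x _; exact: le_trans M0.
  move: (\sum_x v x) (\sum_x nonlin _) => w e w0 e0.
  by have : lambda * e <= 0 by [rewrite pmulr_rle0]; nra.
have [|x [y [_ _]]] := @steep_cut lambda r f v x1 x0 r0 rp.
  by rewrite vE; lra.
have := sumZ (fun z => v x <= v z).
have := sum_nonlin_ge v (fun z => v x <= v z).
have /andP[+ _] := sum_cond_bounds f (fun z => v x <= v z).
have : - (#|V|%:R * r) <= \sum_(z | v x <= v z) v z.
  apply: (@le_trans _ _ (\sum_(z | v x <= v z) - r)).
    rewrite sumr_const mulNrn lerN2 -[leLHS]mulr_natl.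
    by rewrite ler_wpM2r ?(ltW r0) // ler_nat max_card.
  by apply: ler_sum => z _; have /andP[] := bnd z.
have n1 : (1 : R) <= #|V|%:R by rewrite ler1n; apply/card_gt0P; exists x0.
rewrite /f_bound gtr0_norm //.
move: (\sum_(z | _) v z) (\sum_(z | _) f z) (\sum_(z | _) nonlin _)
  (\sum_(z | _) flux _ _ _ _) => w g e F wr gf en FZ FB.
move: sr F1 n1 wr gf en FZ FB.
move: (\sum_x _) (#|V|%:R) => K n sr F1 n1 wr gf en FZ FB.
have sw : - (n * ((1 - s) * K)) <= s * w.
  have : 0 <= s * (w + n * r) by rewrite mulr_ge0 //; lra.
  have : n * (s * r) <= n * ((1 - s) * K) by rewrite ler_wpM2l //; lra.
  lra.
have le : - (lambda * (n / 4)) <= lambda * e by rewrite -mulrN ler_pM2l.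
have nK : K <= n * K by rewrite ler_peMl.
have : 0 < (1 - s) * (F + lambda * e + g - n * K).
  by rewrite mulr_gt0 ?subr_gt0 //; lra.
by lra.
Qed.

(** Summing over [V] removes the flux and the deviations from the mean. The resulting identity
    excludes [v <= 0] with [mean < 0], and also an oscillation below [r], where [v] has constant
    sign. A large oscillation is reduced to the former case by summing over the set below a steep
    edge. The three factors of [#|V|%:R ^+ 3] are spent on the gap along the edge, on the deviations
    below the cut, and on replacing [#|T|] by [#|V|]. *)
Lemma neg_homotopy_nonzero lambda r f v s : 0 < r ->
  \sum_x `|f x| < `|lambda| * r ->
  f_bound lambda f < (r / #|V|%:R) `^ (p - 1) ->
  lambda < 0 -> 0 < \sum_x f x ->
  (forall x, `|v x| <= r) -> (exists x, `|v x| = r) -> 0 <= s <= 1 ->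
  let mean := (\sum_x v x) / #|V|%:R in
  ~ (forall x, (1 - s) * residual lambda f v x +
       s * (#|V|%:R ^+ 3 * (v x - mean) - mean) = 0).
Proof.
move=> r0 lr rp l0 sf vr [x0 vx0] /andP[s0 s1] mean Z.
have F1 : 0 <= \sum_x `|f x| by exact: sumr_ge0.
rewrite ltr0_norm // in lr.
have n1 : (1 : R) <= #|V|%:R by rewrite ler1n; apply/card_gt0P; exists x0.
have n0 : (0 : R) < #|V|%:R by exact: lt_le_trans ltr01 n1.
have meanE : \sum_x v x = #|V|%:R * mean by rewrite /mean mulrC divfK // gt_eqF.
clearbody mean.
have bnd x : - r <= v x <= r by rewrite -ler_norml.
have sumZ (P : pred V) : (1 - s) * (\sum_(x | P x) flux E phi v x +
    lambda * \sum_(x | P x) nonlin (v x) + \sum_(x | P x) f x) +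
    s * (#|V|%:R ^+ 3 * \sum_(x | P x) (v x - mean) - \sum_(x | P x) mean) = 0.
  transitivity (\sum_(x | P x) ((1 - s) * residual lambda f v x +
      s * (#|V|%:R ^+ 3 * (v x - mean) - mean))).
    rewrite [lambda * _]mulr_sumr -!big_split /= [_ ^+ 3 * _]mulr_sumr -sumrB.
    by rewrite 2!mulr_sumr -big_split.
  by apply: big1 => x _; exact: Z.
have sumZT : (1 - s) * (lambda * \sum_x nonlin (v x) + \sum_x f x) -
    s * (#|V|%:R * mean) = 0.
  have := sumZ predT; rewrite (sum_flux0 symE phiN) add0r sumrB meanE.
  by rewrite sumr_const mulr_natl subrr mulr0 sub0r mulrN -mulr_natl.
have {}s1 : s < 1.
  rewrite lt_neqAle s1 andbT; apply/eqP => s1'.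
  have mean0 : mean = 0.
    move: sumZT; rewrite s1' subrr mul0r sub0r mul1r => /eqP.
    by rewrite oppr_eq0 mulf_eq0 (gt_eqF n0) => /eqP.
  have := Z x0; rewrite s1' subrr mul0r add0r mul1r mean0 !subr0 => /eqP.
  rewrite mulf_eq0 expf_eq0 (gt_eqF n0) andbF /= => /eqP v0.
  by move: vx0; rewrite v0 normr0; lra.
have [x1 x1max] : exists x1, forall y, v y <= v x1.
  by have [x1 _ H] := @arg_maxP _ _ _ x0 predT v isT; exists x1 => y; exact: H.
have [x2 x2min] : exists x2, forall y, v x2 <= v y.
  by have [x2 _ H] := @arg_minP _ _ _ x0 predT v isT; exists x2 => y; exact: H.
have neg_absurd : v x1 <= 0 -> mean < 0 -> False.
  move=> M0 mean0.
  have : \sum_x nonlin (v x) <= 0.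
    by apply: sumr_le0 => x _; apply: nonlin_le0; exact: le_trans M0.
  move: sumZT; move: (\sum_x nonlin _) => e Ze e0.
  have le0 : 0 <= lambda * e by rewrite nmulr_rge0.
  have : 0 < (1 - s) * (lambda * e + \sum_x f x).
    by rewrite mulr_gt0 ?subr_gt0 // ltr_wpDl.
  have : s * (#|V|%:R * mean) <= 0 by rewrite mulr_ge0_le0 // nmulr_lle0 // ltW.
  by lra.
have [osc|osc] := leP r (v x1 - v x2).
  have lt12 : v x2 < v x1 by lra.
  have [x [y [lt_yx gap]]] := steep_cut r0 rp osc.
  pose T z := ~~ (v x <= v z).
  have flT : \sum_(z | T z) flux E phi v z = - \sum_(z | v x <= v z) flux E phi v z.
    have := sum_flux0 symE phiN v; rewrite (bigID (fun z => v x <= v z)) /= => h.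
    by apply/eqP; rewrite -addr_eq0 addrC; apply/eqP; exact: h.
  (* [#|V|%:R * (v z - mean)] is the flux of the identity on the complete graph, so the cut estimate
     applies again; the deviations above and below the cut cancel. *)
  have devT : \sum_(z | T z) (v z - mean) <= - ((v x - v y) / #|V|%:R).
    pose C : rel V := fun _ _ => true.
    have symC : symmetric C by [].
    have idN (t : R) : id (- t) = - id t by [].
    have id_ge0 (t : R) : 0 <= t -> 0 <= id t by [].
    have fE z : flux C id v z = #|V|%:R * (v z - mean).
      transitivity (\sum_y (v z - v y)); first exact: eq_bigl.
      by rewrite sumrB sumr_const meanE mulrBr -[v z *+ _]mulr_natl.
    have := upper_cut_flux_ge symC idN id_ge0 (isT : C x y) lt_yx.
    have := sum_flux0 symC idN v; rewrite (bigID (fun z => v x <= v z)) /=.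
    under [X in _ + X]eq_bigr do rewrite fE.
    rewrite -mulr_sumr => h1 h2.
    by rewrite -mulNr ler_pdivlMr // mulrC -/T in h1 *; lra.
  move=> FB; have := sumZ T; rewrite flT.
  have := sum_nonlin_ge v T; have /andP[_ +] := sum_cond_bounds f T.
  rewrite sumr_const -[mean *+ _]mulr_natl.
  have : (#|T|%:R : R) <= #|V|%:R by rewrite ler_nat max_card.
  have : (0 : R) <= #|T|%:R by [].
  have mean_ge : v x2 <= mean.
    rewrite -(ler_pM2l n0) -meanE mulr_natl -sumr_const.
    by apply: ler_sum => z _; exact: x2min.
  move: FB; rewrite /f_bound ltr0_norm //.
  move: devT gap F1 mean_ge; move: (\sum_(z | _) (_ - _)) (\sum_(z | _) f z)
    (\sum_(z | _) nonlin _) (\sum_(z | _) flux _ _ _ _) (\sum_x _) => d g e F K.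
  move=> devT gap K0 mean_ge FB T0 Tn gK en Zn.
  move: devT gap FB Tn en Zn n0 n1 neg_absurd.
  move: (#|V|%:R : R) (#|T|%:R : R) T0 => n t t0 devT gap FB tn en Zn n0 n1 absurd.
  have le : lambda * e <= - lambda * (n / 4).
    by rewrite mulNr -mulrN ler_nM2l.
  have KnK : K <= n * K by rewrite ler_peMl.
  (* Below the cut the flux has the opposite sign and makes this part negative, so the linear part
     must be positive. As the deviations there are very negative, the mean must be too. *)
  have neg : (1 - s) * (- F + lambda * e + g) < 0.
    by rewrite pmulr_rlt0 ?subr_gt0 //; lra.
  have pos : 0 < n ^+ 3 * d - t * mean.
    by rewrite ltNge; apply/negP => le0; have := mulr_ge0_le0 s0 le0; lra.
  have dn : n ^+ 3 * d <= - (n * (v x1 - v x2)).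
    have h1 : n * d <= - (v x - v y).
      by rewrite mulrC -ler_pdivlMr // mulNr.
    have h2 : v x1 - v x2 <= n * (v x - v y).
      by rewrite mulrC -ler_pdivrMr.
    have h3 : n ^+ 2 * (n * d) <= n ^+ 2 * - (v x - v y).
      by rewrite ler_wpM2l // exprn_ge0 // ltW.
    have h4 : n * (v x1 - v x2) <= n * (n * (v x - v y)) by rewrite ler_pM2l.
    by move: h3; rewrite mulrA -exprSr expr2 mulrN -mulrA; lra.
  have nosc : 0 < n * (v x1 - v x2) by rewrite mulr_gt0 // subr_gt0.
  have tmean : t * mean < - (n * (v x1 - v x2)) by lra.
  have mean0 : mean < 0.
    by rewrite ltNge; apply/negP => h; have := mulr_ge0 t0 h; lra.
  have nmean : n * mean < - (n * (v x1 - v x2)).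
    by apply: le_lt_trans tmean; rewrite ler_nM2r.
  have : mean < - (v x1 - v x2) by rewrite -(ltr_pM2l n0) mulrN.
  by move=> hm; apply: absurd => //; lra.
have [vpos|vneg] := lerP 0 (v x0).
  have vE : v x0 = r by rewrite -vx0 ger0_norm.
  have v0 z : 0 <= v z by have := x2min z; have := x1max x0; lra.
  have mean0 : 0 <= #|V|%:R * mean by rewrite -meanE sumr_ge0.
  have er : r <= \sum_x nonlin (v x).
    apply: le_trans (nonlin_ge_id (ltW r0)) _.
    rewrite (bigD1 x0) //= vE lerDl sumr_ge0 // => z _.
    exact: le_trans (nonlin_ge_id (v0 z)).
  have /andP[_ fK] := sum_cond_bounds f predT.
  move: sumZT er fK lr; move: (\sum_x nonlin _) => e Ze er fK lr'.
  have : lambda * e <= lambda * r by rewrite ler_nM2l.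
  have : 0 <= s * (#|V|%:R * mean) by rewrite mulr_ge0.
  move=> h1 h2; have : (1 - s) * (lambda * e + \sum_x f x) < 0.
    by rewrite pmulr_rlt0 ?subr_gt0 //; lra.
  by lra.
have vE : v x0 = - r by rewrite -vx0 ltr0_norm // opprK.
have M0 : v x1 < 0 by have := x2min x0; lra.
apply: neg_absurd; first exact: ltW.
rewrite -(ltr_pM2l n0) mulr0 -meanE (bigD1 x0) //= vE.
rewrite ltr_wnDr //; last by rewrite oppr_lt0.
by apply: sumr_le0 => z _; have := x1max z; lra.
Qed.

End Estimates.

(** * The Chern-Simons map *)

Section ModelMap.
Variables (R : realType) (V : finType) (E : rel V) (p : R).
Hypothesis p1 : 1 < p.
Variables (lambda : R) (f : V -> R).
Local Notation vec := 'rV[R]_#|V|.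

(** One family contains both the map itself, at [e = 0], and its smooth approximations, at
    [e > 0]. *)
Definition model_coord (e : R) (x : V) (u : vec) : R :=
  \sum_(y | E x y) smooth_power p (fun_of u x - fun_of u y) e
    + lambda * nonlin (fun_of u x) + f x.

Definition model_map (e : R) (u : vec) : vec :=
  \row_i model_coord e (enum_val i) u.

Lemma chern_simons_mapE : chern_simons_map p E lambda f = model_map 0.
Proof.
apply/funext => u; apply/rowP => i; rewrite !mxE /model_coord /p_laplacian.
congr (_ + _ + _); rewrite -sumrN; apply: eq_bigr => y _.
by rewrite smooth_power0 distrC -mulrN opprB.
Qed.

Lemma coord_diff_continuous (x y : V) :
  continuous (fun u : vec => fun_of u x - fun_of u y).
Proof.
apply: (@lipschitz_continuous _ _ _ _ 2) => u w.
have -> : fun_of u x - fun_of u y - (fun_of w x - fun_of w y) =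
    (u - w) 0 (enum_rank x) - (u - w) 0 (enum_rank y).
  by rewrite /fun_of !mxE; ring.
apply: le_trans (ler_normB _ _) _.
have := rV_coord_le (u - w) (enum_rank x).
by have := rV_coord_le (u - w) (enum_rank y); lra.
Qed.

Lemma add_continuous_fun (T : topologicalType) (g h : T -> R) :
  continuous g -> continuous h -> continuous (fun x => g x + h x).
Proof. by move=> cg ch x; apply: cvgD; [exact: cg|exact: ch]. Qed.

Lemma sum_continuous (T : topologicalType) (I : Type) (s : seq I) (P : pred I)
    (h : I -> T -> R) : (forall i, continuous (h i)) ->
  continuous (fun x => \sum_(i <- s | P i) h i x).
Proof.
move=> ch; elim: s => [|i s IH] x.
  rewrite (_ : (fun x => _) = cst 0); first exact: cst_continuous.
  by apply/funext => y; rewrite big_nil.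
have [Pi|Pi] := boolP (P i); last first.
  rewrite (_ : (fun x => _) = (fun x => \sum_(i <- s | P i) h i x)); first exact: IH.
  by apply/funext => y; rewrite big_cons (negbTE Pi).
rewrite (_ : (fun x => _) = (fun x => h i x + \sum_(i <- s | P i) h i x)).
  exact: add_continuous_fun.
by apply/funext => y; rewrite big_cons Pi.
Qed.

Lemma is_derive_nonlin (c t : R) :
  is_derive t 1 (fun t => c * nonlin t) (c * (2 * expR t * expR t - expR t)).
Proof.
have De := is_derive_expR t.
have D1 := is_deriveB De (is_derive_cst (1 : R) t 1).
have DM := is_deriveM De D1.
have DZ := is_deriveZ c DM.
apply: (is_derive_eq DZ); rewrite /= !fctE subr0.
rewrite /GRing.scale /=; ring.
Qed.

Lemma C1_coord (n : nat) (j : 'I_n) : C1 (fun u : 'rV[R]_n => u 0 j).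
Proof.
have dj (u : 'rV[R]_n) : differentiable (fun u : 'rV[R]_n => u 0 j) u.
  exact: differentiable_coord.
split=> // v; rewrite (_ : (fun u => _) = cst (v 0 j)); first exact: cst_continuous.
apply/funext => u; rewrite -deriveE //.
have did : derivable (id : 'rV[R]_n -> 'rV[R]_n) u v by exact: derivable_id.
have := derive_mx did; rewrite derive_id.
by move=> /rowP/(_ j); rewrite mxE.
Qed.

Lemma C1_coord_diff (x y : V) : C1 (fun u : vec => fun_of u x - fun_of u y).
Proof.
apply: (C1_add (C1_coord (enum_rank x))).
have ND (t : R) : is_derive t 1 -%R (-1 : R) by exact: is_deriveNid.
apply: (C1_comp ND _ (C1_coord (enum_rank y))); exact: cst_continuous.
Qed.

Lemma model_coord_C1 e x : 0 < e -> C1 (model_coord e x).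
Proof.
move=> e0; apply: C1_add; last exact: C1_cst.
apply: C1_add.
  apply: C1_sum => y.
  exact: (C1_comp (g := fun t => smooth_power p t e)
    (fun t => is_derive_smooth_power p t e0)
    (smooth_power_deriv_continuous (p := p) e0) (C1_coord_diff x y)).
apply: (C1_comp (is_derive_nonlin lambda) _ (C1_coord (enum_rank x))) => t.
have ce : {for t, continuous (@expR R)} by exact: continuous_expR.
apply: cvgM; first exact: cvg_cst.
apply: cvgB; last exact: ce.
by apply: cvgM; [apply: cvgM; [exact: cvg_cst|exact: ce]|exact: ce].
Qed.

Lemma model_map_continuous : continuous (model_map 0).
Proof.
apply: row_valued_continuous => i.
have cexp : continuous (fun u : vec => lambda * nonlin (fun_of u (enum_val i))).
  move=> u.
  apply: (@continuous_comp _ _ _ (fun u : vec => u 0 (enum_rank (enum_val i)))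
    (fun t => lambda * nonlin t)); first exact: coord_continuous.
  by apply: differentiable_continuous; apply/derivable1_diffP;
    case: (is_derive_nonlin lambda (u 0 (enum_rank (enum_val i)))).
have csum : continuous (fun u : vec => \sum_(y | E (enum_val i) y)
    smooth_power p (fun_of u (enum_val i) - fun_of u y) 0).
  apply: sum_continuous => y u.
  apply: (@continuous_comp _ _ _ (fun u : vec => fun_of u (enum_val i) - fun_of u y)
    (fun t => smooth_power p t 0)); first exact: coord_diff_continuous.
  apply: (@continuous_comp _ _ _ (fun t : R => (t, 0 : R))
    (fun z => smooth_power p z.1 z.2)); last exact: smooth_power_continuous.
  apply: (@lipschitz_continuous _ _ _ (fun t : R => (t, 0 : R)) 1) => t t'.
  by rewrite mul1r prod_normE /= subrr normr0 max_l.
apply: add_continuous_fun; last exact: cst_continuous.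
exact: add_continuous_fun.
Qed.

Lemma model_map_approx r eta : 0 < eta ->
  exists2 H : vec -> vec,
     (forall x, differentiable H x) /\ continuous (jacobian H) &
     forall u, `|u| <= r -> `|H u - model_map 0 u| < eta.
Proof.
(* At most [#|V|] errors are added, and differences of coordinates stay within [2 * r]. *)
move=> eta0; have d0 : 0 < eta / #|V|.+1%:R by rewrite divr_gt0.
have [e e0 eP] := smooth_power_uniform p1 (2 * r) d0.
exists (model_map e) => [|u ur].
  by apply: C1_rows => i; exact: model_coord_C1.
apply: rV_norm_lt => // i; rewrite !mxE /model_coord.
set x := enum_val i.
have -> : \sum_(y | E x y) smooth_power p (fun_of u x - fun_of u y) e +
    lambda * nonlin (fun_of u x) + f x -
    (\sum_(y | E x y) smooth_power p (fun_of u x - fun_of u y) 0 +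
      lambda * nonlin (fun_of u x) + f x) =
    \sum_(y | E x y) (smooth_power p (fun_of u x - fun_of u y) e -
      smooth_power p (fun_of u x - fun_of u y) 0).
  by rewrite sumrB; ring.
apply: le_lt_trans (ler_norm_sum _ _ _) _.
apply: (@le_lt_trans _ _ (\sum_(y | E x y) eta / #|V|.+1%:R)).
  apply: ler_sum => y _; apply: ltW; apply: eP.
  apply: le_trans (ler_normB _ _) _.
  have := rV_coord_le u (enum_rank x); have := rV_coord_le u (enum_rank y).
  by rewrite /fun_of; lra.
rewrite sumr_const -[_ *+ #|_|]mulr_natr mulrAC ltr_pdivrMr // ltr_pM2l // ltr_nat ltnS.
exact: max_card.
Qed.

End ModelMap.

(** * Linear targets of the homotopies, and the choice of the radius *)

Section RankOneDeterminant.
Variable R : comNzRingType.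

(** The matrix determinant lemma: [M *m T] and [T *m M] have equal determinants and are both block
    triangular, one with the block [1 + u v], the other with the scalar [1 + v u]. *)
Lemma det_add_rank1 n (u : 'cV[R]_n) (v : 'rV[R]_n) :
  \det (1%:M + u *m v) = 1 + (v *m u) 0 0.
Proof.
pose M := block_mx (1%:M : 'M[R]_1) (- v) u 1%:M.
pose T := block_mx (1%:M : 'M[R]_1) v 0 (1%:M : 'M[R]_n).
have dT : \det T = 1 by rewrite det_ublock !det1 mulr1.
have <- : \det (M *m T) = \det (1%:M + u *m v).
  rewrite mulmx_block !mulmx0 !mulmx1 !mul1mx !addr0 addrN.
  by rewrite det_lblock det1 mul1r addrC.
have -> : \det (M *m T) = \det (T *m M) by rewrite !det_mulmx mulrC.
rewrite mulmx_block !mul0mx !mul1mx !mulmx1 !add0r addNr.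
by rewrite det_lblock det1 mulr1 det_mx11 !mxE eqxx.
Qed.

End RankOneDeterminant.

Section LinearModels.
Variables (R : realType) (n : nat).

(* The linear map that is [a] on the vectors of mean 0 and [-1] on the constants. *)
Definition reflected_mean (a : R) : 'M[R]_n :=
  a *: (1%:M + (const_mx 1 : 'cV_n) *m const_mx (- ((a + 1) / n%:R / a))).

Lemma mul_reflected_mean (a : R) (z : 'rV[R]_n) j : a != 0 ->
  (z *m reflected_mean a) 0 j =
  a * (z 0 j - (\sum_i z 0 i) / n%:R) - (\sum_i z 0 i) / n%:R.
Proof.
move=> a0; rewrite /reflected_mean -scalemxAr mulmxDr mulmx1 mulmxA !mxE big_ord1.
rewrite !mxE (eq_bigr (fun i => z 0 i)) => [|i _]; last by rewrite mxE mulr1.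
have [->|n0] := eqVneq (n%:R : R) 0; first by rewrite invr0; ring.
by field; rewrite a0 n0.
Qed.

Lemma det_reflected_mean_lt0 (a : R) : (0 < n)%N -> 0 < a ->
  \det (reflected_mean a) < 0.
Proof.
move=> n0 a0; rewrite detZ det_add_rank1 pmulr_rlt0 ?exprn_gt0 // mxE.
rewrite (eq_bigr (fun=> - ((a + 1) / n%:R / a))) => [|i _]; last first.
  by rewrite !mxE mulr1.
rewrite sumr_const card_ord -[_ *+ n]mulr_natl.
have nR : (n%:R : R) != 0 by rewrite pnatr_eq0 -lt0n.
have -> : 1 + n%:R * - ((a + 1) / n%:R / a) = - a^-1.
  by field; rewrite nR gt_eqF.
by rewrite oppr_lt0 invr_gt0.
Qed.

End LinearModels.

Lemma rV_norm_attained (R : realType) n (x : 'rV[R]_n) : 0 < `|x| ->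
  exists j, `|x 0 j| = `|x|.
Proof.
by case: n x => [x|n x _]; [rewrite (thinmx0 x) normr0 ltxx|exact: rV_norm_coord].
Qed.

(** [t] is chosen so that its power [p - 1] is [C + 1]. Both conditions persist for larger radii, so
    their thresholds may be added. *)
Lemma radius_threshold (R : realType) (p C F l n : R) :
  1 < p -> 0 <= C -> 0 <= F -> 0 < l -> 0 < n ->
  exists2 r0, 0 < r0 & forall r, r0 <= r -> F < l * r /\ C < (r / n) `^ (p - 1).
Proof.
move=> p1 C0 F0 l0 n0; pose t := (C + 1) `^ (p - 1)^-1.
have t0 : 0 <= t by rewrite powR_ge0.
have Fl : 0 <= F / l by rewrite divr_ge0 // ltW.
have nt : 0 <= n * t by rewrite mulr_ge0 // ltW.
have p10 : 0 < p - 1 by rewrite subr_gt0.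
exists (1 + F / l + n * t) => [|r rr]; first by lra.
split; first by rewrite mulrC -ltr_pdivrMr //; lra.
have tr : t <= r / n by rewrite ler_pdivlMr // mulrC; lra.
apply: (@lt_le_trans _ _ (t `^ (p - 1))).
  by rewrite -powRrM mulVf ?gt_eqF // powRr1; lra.
by apply: ge0_ler_powR; rewrite ?nnegrE ?(ltW p10) // (le_trans t0).
Qed.

Theorem theorem1p2 (R : realType) (p : R) (V : finType) (E : rel V)
    (lambda : R) (f : V -> R) :
  1 < p ->
  symmetric E ->
  (forall x y : V, connect E x y) ->
  lambda * (\sum_(x : V) f x) < 0 ->
  exists R0 : R, 0 < R0 /\
    forall r : R, R0 <= r ->
      let F := chern_simons_map p E lambda f in
      let B : set 'rV[R]_#|V| := open_ball r in
      degree_defined F B 0 /\ brouwer_degree F B 0 = sgz lambda.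
Proof.
move=> p1 symE conE lf.
have lambda0 : lambda != 0 by apply: contraTneq lf => ->; rewrite mul0r ltxx.
have V0 : (0 < #|V|)%N.
  rewrite lt0n; apply: contraTneq lf => /card0_eq V0.
  by rewrite big_pred0 ?mulr0 ?ltxx // => x; have := V0 x; rewrite inE.
have n0 : (0 : R) < #|V|%:R by rewrite ltr0n.
have F0 : 0 <= \sum_x `|f x| by exact: sumr_ge0.
have C0 : 0 <= f_bound lambda f.
  by rewrite mulr_ge0 ?addr_ge0 ?mulr_ge0 // divr_ge0.
have l0 : 0 < `|lambda| by rewrite normr_gt0.
have [R0 R00 R0P] := radius_threshold p1 C0 F0 l0 n0.
exists R0; split=> // r R0r F B.
have r0 : 0 < r by exact: lt_le_trans R0r.
have [lr rp] := R0P r R0r.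
rewrite /F /B chern_simons_mapE.
have zr (z : 'rV[R]_#|V|) x : `|z| = r -> `|fun_of z x| <= r.
  by move=> <-; exact: rV_coord_le.
have ze (z : 'rV[R]_#|V|) : `|z| = r -> exists x, `|fun_of z x| = r.
  move=> zE; have [|j zj] := rV_norm_attained (x := z); first by rewrite zE.
  by exists (enum_val j); rewrite /fun_of enum_valK zj.
have entry (z : 'rV[R]_#|V|) (A : 'M[R]_#|V|) s x :
    (1 - s) *: model_map E p lambda f 0 z + s *: (z *m A) = 0 ->
    (1 - s) * residual E p lambda f (fun_of z) x +
      s * (z *m A) 0 (enum_rank x) = 0.
  move=> /rowP/(_ (enum_rank x)); rewrite [in RHS]mxE => <-.
  rewrite [RHS]mxE [(_ *: _ : 'rV__) _ _]mxE [(s *: _ : 'rV__) _ _]mxE.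
  by rewrite [model_map _ _ _ _ _ _ _ _]mxE enum_rankK.
have cF : continuous (model_map E p lambda f 0) by exact: model_map_continuous.
case: (ltrgt0P lambda) lambda0 => // lpos _.
  have sf : \sum_x f x < 0 by rewrite -(pmulr_rlt0 _ lpos).
  have := @brouwer_degree_linear_homotopic R #|V| (model_map E p lambda f 0)
    1%:M r V0 r0 cF.
  rewrite det1 sgz1 gtr0_sgz //; apply; first exact: oner_neq0.
    move=> z s zE s01; apply/eqP => /entry Z.
    apply: (@pos_homotopy_nonzero R V E p p1 symE conE lambda r f (fun_of z) s) => //.
    - by move=> x; exact: zr.
    - exact: ze.
    by move=> x; have := Z x; rewrite mulmx1.
  exact: model_map_approx.
have sf : 0 < \sum_x f x by rewrite -(nmulr_rlt0 _ lpos).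
have a0 : (0 : R) < #|V|%:R ^+ 3 by rewrite exprn_gt0.
have detA := det_reflected_mean_lt0 V0 a0.
have := @brouwer_degree_linear_homotopic R #|V| (model_map E p lambda f 0)
  (reflected_mean #|V| (#|V|%:R ^+ 3)) r V0 r0 cF.
rewrite (ltr0_sgz detA) (ltr0_sgz lpos); apply; first by rewrite lt_eqF.
  move=> z s zE s01; apply/eqP => /entry Z.
  apply: (@neg_homotopy_nonzero R V E p p1 symE conE lambda r f (fun_of z) s) => //.
  - by move=> x; exact: zr.
  - exact: ze.
  move=> x; have := Z x; rewrite mul_reflected_mean ?gt_eqF //.
  have -> // : \sum_i z 0 i = \sum_y fun_of z y.
  by rewrite (reindex _ (onW_bij _ (@enum_rank_bij V))).
exact: model_map_approx.
Qed.
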